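(* Let $f\in H^2(\mathbb{D})$ and let $n\ge 1$. Put $\tilde f_1=f$ and, for $k=1,\dots,n$, let $a_k\in\mathbb{D}$ be an optimally selected parameter, i.e. $$|\langle \tilde f_k,e_{a_k}\rangle|=\max\{|\langle \tilde f_k,e_a\rangle| : a\in\mathbb{D}\},$$ and define $$\tilde f_{k+1}(z)=\frac{\tilde f_k(z)-\langle \tilde f_k,e_{a_k}\rangle e_{a_k}(z)}{\left(\frac{z-a_k}{1-\overline{a}_kz}\right)^2}.$$ Then each $\tilde f_{k+1}$, $k=1,\dots,n$, is (after removing the singularity at $a_k$) a function in $H^2(\mathbb{D})$, and $$f(z)=\sum_{k=1}^n\langle \tilde f_k,e_{a_k}\rangle\tilde B_k(z)+\tilde f_{n+1}(z)\prod_{k=1}^n\left(\frac{z-a_k}{1-\overline{a}_kz}\right)^2,\qquad z\in\mathbb{D}.$$ Consequently the orthogonal projection $S_n=\sum_{k=1}^n\langle \tilde f_k,e_{a_k}\rangle\tilde B_k$ of $f$ onto $\mathrm{span}\{\tilde B_1,\dots,\tilde B_n\}$ interpolates $f$ to second order at all the distinct selected points: $$S_n(a_k)=f(a_k),\qquad S_n'(a_k)=f'(a_k),\qquad k=1,\dots,n.$$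
   Context: $\mathbb{D}$ is the open unit disc and $H^2(\mathbb{D})$ is the Hardy space of functions $f(z)=\sum_{k\ge0}c_kz^k$ with $\|f\|^2=\sum_{k\ge 0}|c_k|^2<\infty$, with inner product $\langle f,g\rangle=\frac1{2\pi}\int_0^{2\pi}f(e^{it})\overline{g(e^{it})}\,dt$ of the boundary values. For $a\in\mathbb{D}$, $e_a(z)=\frac{\sqrt{1-|a|^2}}{1-\overline{a}z}$ is the normalized Szegő kernel, so that $\langle f,e_a\rangle=\sqrt{1-|a|^2}\,f(a)$. For the parameters $a_1,a_2,\dots\in\mathbb{D}$ the double Takenaka–Malmquist system is $\tilde B_1=e_{a_1}$ and $\tilde B_k(z)=e_{a_k}(z)\prod_{l=1}^{k-1}\left(\frac{z-a_l}{1-\overline{a}_lz}\right)^2$ for $k\ge2$; it is an orthonormal system in $H^2(\mathbb{D})$. *)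

(* Defs.v *)
From HB Require Import structures.
From mathcomp Require Import all_boot all_order all_algebra.
From mathcomp Require Import complex.
From mathcomp Require Import all_classical all_reals all_analysis.

Set Implicit Arguments.
Unset Strict Implicit.
Unset Printing Implicit Defensive.
Import Order.TTheory GRing.Theory Num.Theory.
Import numFieldNormedType.Exports.

Local Open Scope classical_set_scope.
Local Open Scope ring_scope.
Local Open Scope complex_scope.

(* R[i] has the topology of its modulus and is normed over itself, so that
   derivatives of functions R[i] -> R[i] are complex derivatives. *)
HB.instance Definition _ (R : realType) := GRing.ComAlgebra.copy R[i] R[i]^o.
HB.instance Definition _ (R : realType) := Vector.copy R[i] R[i]^o.
HB.instance Definition _ (R : realType) := NormedModule.copy R[i] R[i]^o.

(* Functions on the open unit disc are total functions R[i] -> R[i]; only their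
   values on the disc matter. *)

Definition in_disc (R : realType) (z : R[i]) : Prop := `|z| < 1.

Definition hardy2 (R : realType) (f : R[i] -> R[i]) : Prop :=
  exists c : nat -> R[i],
    cvgn (series (fun k => ComplexField.Normc.normc (c k) ^+ 2)) /\
    forall z, in_disc z -> series (fun k => c k * z ^+ k) @ \oo --> f z.

Definition expi (R : realType) (t : R) : R[i] := cos t +i* sin t.

(* The boundary value at e^(it) is the radial limit; for f in the Hardy space it
   exists for almost every t. Where it does not exist, [lim] is a default
   value. *)
Definition boundary (R : realType) (f : R[i] -> R[i]) (t : R) : R[i] :=
  lim (f (r%:C * expi t) @[r --> (1 : R)^'-]).

Definition cintegral (R : realType) (F : R -> R[i]) : R[i] :=
  (\int[lebesgue_measure]_(t in `[0, 2 * pi]) complex.Re (F t)) +i*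
  (\int[lebesgue_measure]_(t in `[0, 2 * pi]) complex.Im (F t)).

Definition inner (R : realType) (f g : R[i] -> R[i]) : R[i] :=
  (2 * pi)^-1%:C * cintegral (fun t => boundary f t * (boundary g t)^*%C).

Definition szego (R : realType) (a z : R[i]) : R[i] :=
  sqrtC (1 - `|a| ^+ 2) / (1 - a^*%C * z).

Definition blaschke (R : realType) (a z : R[i]) : R[i] :=
  (z - a) / (1 - a^*%C * z).

(* Sequences of parameters and of functions are indexed from 1; the value at
   index 0 is irrelevant. *)
Definition double_TM (R : realType) (a : nat -> R[i]) (k : nat) (z : R[i]) :
    R[i] :=
  szego (a k) z * \prod_(1 <= l < k) blaschke (a l) z ^+ 2.

Definition optimal (R : realType) (f : R[i] -> R[i]) (a : R[i]) : Prop :=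
  in_disc a /\
  forall b, in_disc b -> `|inner f (szego b)| <= `|inner f (szego a)|.

Definition sift_quotient (R : realType) (f : R[i] -> R[i]) (a z : R[i]) :
    R[i] :=
  (f z - inner f (szego a) * szego a z) / blaschke a z ^+ 2.

Definition remove_sing (R : realType) (q : R[i] -> R[i]) (a z : R[i]) : R[i] :=
  if z == a then lim (q w @[w --> a^']) else q z.

Fixpoint remainder (R : realType) (f : R[i] -> R[i]) (a : nat -> R[i])
    (k : nat) : R[i] -> R[i] :=
  if k is j.+1 then
    if j is 0%N then f
    else remove_sing (sift_quotient (remainder f a j) (a j)) (a j)
  else f.

Definition coef (R : realType) (f : R[i] -> R[i]) (a : nat -> R[i]) (k : nat) :
    R[i] :=
  inner (remainder f a k) (szego (a k)).

Definition partial_sum (R : realType) (f : R[i] -> R[i]) (a : nat -> R[i])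
    (n : nat) (z : R[i]) : R[i] :=
  \sum_(1 <= k < n.+1) coef f a k * double_TM a k z.

Definition in_span (R : realType) (B : nat -> R[i] -> R[i]) (n : nat)
    (g : R[i] -> R[i]) : Prop :=
  exists l : nat -> R[i],
    forall z, in_disc z -> g z = \sum_(1 <= k < n.+1) l k * B k z.

Definition is_orth_proj (R : realType) (B : nat -> R[i] -> R[i]) (n : nat)
    (f P : R[i] -> R[i]) : Prop :=
  in_span B n P /\
  forall g, in_span B n g -> inner (fun z => f z - P z) g = 0.

(* Main.v *)
Require Import Defs.
From HB Require Import structures.
From mathcomp Require Import all_boot all_order all_algebra.
From mathcomp Require Import complex.
From mathcomp Require Import all_classical all_reals all_analysis.
From mathcomp Require Import measurable_realfun ring lra zify.
Import Order.TTheory GRing.Theory Num.Theory.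
Import numFieldNormedType.Exports.
Local Open Scope ring_scope.
Local Open Scope classical_set_scope.

(** Let r be the residual of f after one step at the optimal parameter a, that
is f - <f, e_a> e_a. The reproducing property makes |<f, e_b>|^2 equal to
(1 - |b|^2) |f(b)|^2, and comparing this with its maximum at b = a to first
order in b - a forces r to vanish to second order at a
([optimal_double_zero]). Hence r is the square of a Blaschke factor times a
function of H^2 ([sift_step]), and iterating gives the expansion of f
([sifting_expansion]). Its last term has a double zero at every a_k, which is
the interpolation statement, and it is orthogonal to each basis function:
since a Blaschke factor b_l satisfies b_l conj(b_l) = 1 on the circle, the
boundary values of (f - S_n) conj(B_k) are those of an H^2 function that
vanishes at 0, and such a function has integral 0.

Membership in H^2 is a condition on power series coefficients, so products and
quotients with z - a and 1 - conj(a) z reduce to one-step recurrences between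
coefficients. The key quotient is f(z) = f(a) + (z - a) g(z) with g in H^2
([hardy2_factor]); it yields zeros, continuity and derivatives at once.

The inner product is an integral of radial limits, so it can only be computed
once radial limits are known to exist almost everywhere and to form an
integrable function with the right mean ([hardy2_fatou]). For real
trigonometric series ([trig_fatou]) this goes as follows. Square-summable
coefficients make the partial sums converge in L1 to some g ([L1_complete]);
a primitive of g is differentiable with derivative g almost everywhere, by
Lebesgue's theorem; and at such a point the Abel means are averages of
symmetric difference quotients of the primitive against a positive kernel,
obtained from the Poisson kernel by one integration by parts
([abel_sum_cvg]). The mean value property then gives the reproducing property
([inner_szego]): with f = f(a) + (z - a) g, on the circle f conj(e_a) is the
sum of a multiple of z g and of the conjugate of a multiple of
1 / (1 - conj(a) z). *)

Set Implicit Arguments.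
Unset Strict Implicit.

(** * Integrals modulo null sets and completeness of L1 *)

Section measure.
Context d (T : measurableType d) (R : realType) (mu : {measure set T -> \bar R}).
Import HBNNSimple.
Local Open Scope ereal_scope.

(** A simple function below [f] stays below [g] once it is set to 0 on [N], and this
does not change its integral. The functions may fail to be measurable, as
boundary values known only off a null set can. *)
Lemma le_integral_off_null (N : set T) (f g : T -> \bar R) :
  measurable N -> mu N = 0 -> (forall x, 0 <= f x) -> (forall x, 0 <= g x) ->
  (forall x, ~ N x -> f x = g x) -> \int[mu]_x f x <= \int[mu]_x g x.
Proof.
move=> mN N0 f0 g0 fg; rewrite !ge0_integralTE//.
apply: ge_ereal_sup => _ [h /= hf <-].
have mNC : measurable (~` N) by exact: measurableC.
pose h' := proj_nnsfun h mNC.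
have h'E : h' = h \_ (~` N) :> (T -> R) by rewrite mrestrict.
apply: (@le_trans _ _ (sintegral mu h')); last first.
  apply: ereal_sup_ubound; exists h' => // x.
  suff : ((h \_ (~` N)) x)%:E <= g x by rewrite -h'E.
  rewrite patchE.
  by case: ifPn => // /set_mem Nx; rewrite -fg.
rewrite -!integralT_nnsfun (@ge0_ae_eq_integral _ _ _ mu setT (EFin \o h) (EFin \o h')) //.
- by apply/measurable_EFinP; exact: measurable_funP.
- by apply/measurable_EFinP; exact: measurable_funP.
- by move=> x _; rewrite lee_fin.
- by move=> x _; rewrite lee_fin.
- exists N; split=> // x /= H; apply: contrapT => Nx; apply: H => _.
  suff : (h x)%:E = ((h \_ (~` N)) x)%:E by rewrite -h'E.
  by rewrite patchE mem_set.
Qed.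

Lemma eq_integral_off_null (D N : set T) (f g : T -> \bar R) :
  measurable N -> mu N = 0 -> (forall x, D x -> ~ N x -> f x = g x) ->
  \int[mu]_(x in D) f x = \int[mu]_(x in D) g x.
Proof.
move=> mN N0 fg; rewrite integral_mkcond [RHS]integral_mkcond.
have fgN x : ~ N x -> (f \_ D) x = (g \_ D) x.
  move=> Nx; rewrite !patchE; case: ifPn => // /set_mem Dx; exact: fg.
rewrite integralE [RHS]integralE; congr (_ - _); apply/eqP; rewrite eq_le.
  by rewrite !(le_integral_off_null mN) // => x Nx; rewrite !funeposE fgN.
by rewrite !(le_integral_off_null mN) // => x Nx; rewrite !funenegE fgN.
Qed.

(** Riesz-Fischer argument: along a subsequence with distances at most [2^-j] the
absolute increments have an integrable sum, which dominates the subsequence and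
makes it converge almost everywhere. *)
Lemma L1_complete (D : set T) (u : nat -> T -> R) : measurable D ->
  (forall n, mu.-integrable D (EFin \o u n)) ->
  (forall e : R, (0 < e)%R -> exists N, forall m n, (N <= m)%N -> (N <= n)%N ->
     \int[mu]_(x in D) `|(u m x - u n x)%:E| <= e%:E) ->
  exists g : T -> R, mu.-integrable D (EFin \o g) /\
    forall e : R, (0 < e)%R -> exists N, forall n, (N <= n)%N ->
      \int[mu]_(x in D) `|(u n x - g x)%:E| <= e%:E.
Proof.
move=> mD iu cu.
have mu_ n : measurable_fun D (u n).
  by apply/measurable_EFinP; exact: (measurable_int mu (iu n)).
have mud m n : measurable_fun D (fun x => `|(u m x - u n x)%:E|).
  apply: measurableT_comp => //; apply/measurable_EFinP.
  exact: measurable_funB.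
have p0 j : (0 < (2^-1 : R) ^+ j)%R by rewrite exprn_gt0.
have [phi phiP] := choice (fun j => cu _ (p0 j)).
(* the summand [j] makes [psi] tend to infinity *)
pose psi j := (\max_(i < j.+1) phi i + j)%N.
have psiP j k : (j <= k)%N -> (phi j <= psi k)%N.
  by move=> jk; rewrite /psi -ltnS in jk *; exact: leq_trans (leq_bigmax (Ordinal jk)) (leq_addr _ _).
pose v j := u (psi j).
have mv j : measurable_fun D (v j) by exact: mu_.
pose dd j x := `|(v j.+1 x - v j x)%:E|.
have mdd j : measurable_fun D (dd j) by exact: mud.
have idd j : \int[mu]_(x in D) dd j x <= (2^-1 ^+ j)%:E.
  by apply: phiP; exact: psiP.
pose G x := `|(v 0%N x)%:E| + \sum_(j <oo) dd j x.
have mabs : measurable_fun D (fun x => `|(v 0%N x)%:E|).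
  by apply: measurableT_comp => //; apply/measurable_EFinP.
have msum : measurable_fun D (fun x => \sum_(j <oo) dd j x).
  by apply: ge0_emeasurable_sum => // j x *; exact: abse_ge0.
have mG : measurable_fun D G by exact: emeasurable_funD.
have sum0 x : 0 <= \sum_(j <oo) dd j x by apply: nneseries_ge0 => *; exact: abse_ge0.
have G0 x : 0 <= G x by rewrite adde_ge0.
have iG : mu.-integrable D G.
  apply/integrableP; split => //.
  under eq_integral do rewrite gee0_abs//.
  rewrite ge0_integralD//; apply: lte_add_pinfty.
    by have /integrableP[] := iu (psi 0%N).
  rewrite integral_nneseries//; last by move=> *; exact: abse_ge0.
  apply: (@le_lt_trans _ _ (\sum_(j <oo) (2^-1 ^+ j)%:E)).
    by apply: lee_nneseries => // j _ _; apply: integral_ge0 => x _; exact: abse_ge0.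
  have half : eseries (fun j => (2^-1 ^+ j)%:E : \bar R) @ \oo --> (2%:E : \bar R).
    apply: cvg_EFin.
      by apply: nearW => n; rewrite /eseries /= sumEFin.
    rewrite [X in X @ _ --> _](_ : _ = series (geometric 1 2^-1)%R); last first.
      by apply/funext => n; rewrite /eseries /series /= sumEFin; apply: eq_bigr => i _; rewrite /= mul1r.
    have := @cvg_geometric_series R 1%R 2^-1.
    have -> : ((1 - 2^-1)^-1 = 2 :> R)%R by field.
    by rewrite mul1r; apply; rewrite ger0_norm // invf_lt1 // ltr1n.
  by rewrite (cvg_lim _ half) // ltry.
pose gE x := limn_esup (fun j => (v j x)%:E).
have mgE : measurable_fun D gE.
  by apply: measurable_fun_limn_esup => j; apply/measurable_EFinP.
pose g x := fine (gE x).
have mg : measurable_fun D g by exact: measurableT_comp.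
have domi j x : `|(v j x)%:E| <= G x.
  apply: (@le_trans _ _ (`|(v 0%N x)%:E| + \sum_(0 <= i < j) dd i x)).
    elim: j => [|j IH]; first by rewrite big_geq // adde0.
    rewrite big_nat_recr //= addeA; apply: le_trans (leeD IH (lexx _)).
    rewrite /dd !abse_EFin -EFinD lee_fin addrC.
    by rewrite -{1}(subrK (v j x) (v j.+1 x)) ler_normD.
  by rewrite leeD2l //; apply: nneseries_lim_ge => *; exact: abse_ge0.
have cvgv : {ae mu, forall x, D x -> (fun j => (v j x)%:E) @ \oo --> (EFin \o g) x}.
  have := integrable_ae mD iG; apply: filterS => x /[swap] Dx /(_ Dx) Gfin.
  have sfin : \sum_(j <oo) dd j x < +oo.
    rewrite ltey; apply/eqP => E; move: Gfin; rewrite /G E.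
    by rewrite addey.
  have : cvgn (series (fun j => (v j.+1 x - v j x)%R)).
    by apply: normed_cvg; apply: nnseries_is_cvg => [i|]; [exact: normr_ge0|exact: sfin].
  move=> ct.
  have cv : cvgn (v ^~ x).
    have -> : v ^~ x = (fun n => v 0%N x + series (fun j => v j.+1 x - v j x) n)%R.
      apply/funext => n; rewrite -[series _]/(series (telescope (v ^~ x))).
      by rewrite (eq_sum_telescope (v ^~ x) n).
    by apply: is_cvgD => //; exact: is_cvg_cst.
  have cE : (fun j => (v j x)%:E) @ \oo --> (limn (v ^~ x))%:E.
    by apply: cvg_EFin => //; exact: nearW.
  suff -> : (EFin \o g) x = (limn (v ^~ x))%:E by [].
  rewrite /= /g /gE is_cvg_limn_esupE; last by apply/cvg_ex; eexists; exact: cE.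
  by rewrite (cvg_lim _ cE).
have mEg : measurable_fun D (EFin \o g) by exact/measurable_EFinP.
have mEv j : measurable_fun D (EFin \o v j) by exact/measurable_EFinP.
have [ig + _] := dominated_convergence mD mEv mEg cvgv iG
  (aeW _ (fun x n (_ : D x) => domi n x)).
move=> /fine_cvgP[vfin /cvgrPdist_le vg].
exists g; split => // e e0.
have e20 : (0 < e / 2)%R by rewrite divr_gt0.
have [N NP] := cu _ e20.
have [M _ MP] := filterI vfin (vg _ e20).
exists N => n Nn; pose j := maxn M N.
have [jfin jle] := MP j (leq_maxl M N).
have vgj : \int[mu]_(x in D) `|(v j x - g x)%:E| <= (e / 2)%:E.
  change ([sequence \int[mu]_(x in D) `|(EFin \o v n) x - (EFin \o g) x|]_n j <= (e / 2)%:E).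
  rewrite -(fineK jfin) lee_fin; apply: le_trans jle.
  by rewrite sub0r normrN ler_norm.
have mvg k : measurable_fun D (fun x => `|(u k x - g x)%:E|).
  by apply: measurableT_comp => //; apply/measurable_EFinP; exact: measurable_funB.
apply: (@le_trans _ _ (\int[mu]_(x in D) (`|(u n x - u (psi j) x)%:E| +
    `|(v j x - g x)%:E|))).
  apply: ge0_le_integral => //.
  - by apply: emeasurable_funD => //; exact: mvg.
  - move=> x _; rewrite -EFinD lee_fin -(subrKA (v j x)).
    exact: ler_normD.
rewrite ge0_integralD //; last exact: mvg.
have -> : e%:E = (e / 2)%:E + (e / 2)%:E by rewrite -EFinD -splitr.
apply: leeD => //; apply: NP => //.
by apply: leq_trans (leq_maxr M N) _; rewrite /psi leq_addl.
Qed.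

End measure.

(** * Trigonometric series with square-summable coefficients *)

Lemma is_derive_mulkx (R : realType) (k x : R) : is_derive x 1 (fun y => k * y) k.
Proof. by apply: (@is_derive_eq _ _ _ (k \*: id)); rewrite scaler1. Qed.

Lemma is_derive_coskx (R : realType) (k x : R) :
  is_derive x 1 (fun y => cos (k * y)) (- (k * sin (k * x))).
Proof.
apply: (@is_derive_eq _ _ _ (@cos R \o (fun y => k * y)) _ _ _ (- sin (k * x) * k)).
  apply: is_derive1_comp; exact: is_derive_mulkx.
by ring.
Qed.
Lemma is_derive_sinkx (R : realType) (k x : R) :
  is_derive x 1 (fun y => sin (k * y)) (k * cos (k * x)).
Proof.
apply: (@is_derive_eq _ _ _ (@sin R \o (fun y => k * y)) _ _ _ (cos (k * x) * k)).
  apply: is_derive1_comp; exact: is_derive_mulkx.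
by ring.
Qed.
Lemma Rintegral_derive (R : realType) (F f : R -> R) (a b : R) : a < b ->
  (forall x : R, is_derive x (1 : R) F (f x)) -> continuous f ->
  \int[lebesgue_measure]_(x in `[a, b]) f x = F b - F a.
Proof.
move=> ab dF cf.
have cF : continuous F.
  by move=> x; apply/differentiable_continuous/derivable1_diffP.
rewrite /Rintegral (@continuous_FTC2 _ f F) //.
- by apply: continuous_subspaceT.
- split; [by move=> x _; case: (dF x)| |].
    by apply: cvg_at_right_filter; exact: cF.
  by apply: cvg_at_left_filter; exact: cF.
- by move=> x _; rewrite derive1E; case: (dF x).
Qed.

Lemma continuous_itv_integrable (R : realType) (f : R -> R) (a b : R) :
  continuous f -> lebesgue_measure.-integrable `[a, b] (EFin \o f).
Proof.
move=> cf; apply: continuous_compact_integrable; first exact: segment_compact.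
exact: continuous_subspaceT.
Qed.

Lemma Rintegral_cst_itv (R : realType) (a b c : R) : a < b ->
  \int[lebesgue_measure]_(x in `[a, b]) c = c * (b - a).
Proof.
move=> ab; rewrite Rintegral_cst //.
change (c * fine (lebesgue_measure `[a, b]%classic) = c * (b - a)).
by rewrite lebesgue_measure_itv /= lte_fin ab.
Qed.

Lemma sin_natpi (R : realType) k : sin (k%:R * pi) = 0 :> R.
Proof.
rewrite mulr_natl; elim: k => [|n IH]; first by rewrite mulr0n sin0.
by rewrite mulrSr sinDpi IH oppr0.
Qed.

Section trig.
Context (R : realType).
Local Notation mu := (@lebesgue_measure R).
Implicit Types (al be : nat -> R) (k : nat) (x : R).

Definition trig al be k x := al k * cos (k%:R * x) - be k * sin (k%:R * x).
Definition trigsum al be n x := \sum_(0 <= k < n) trig al be k x.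
(** Two full periods, so that the interval from [t - h] to [t + h] stays inside for
[0 <= t <= 2 pi] and [0 <= h <= pi]. *)
Definition period2 : set R := `[- pi, 3 * pi].
Let I := period2.

Lemma continuous_coskx (k x : R) : {for x, continuous (fun y : R => cos (k * y))}.
Proof. by apply/differentiable_continuous/derivable1_diffP; case: (is_derive_coskx k x). Qed.

Lemma continuous_sinkx (k x : R) : {for x, continuous (fun y : R => sin (k * y))}.
Proof. by apply/differentiable_continuous/derivable1_diffP; case: (is_derive_sinkx k x). Qed.

Lemma continuous_trig al be k : continuous (trig al be k).
Proof.
move=> x; rewrite /trig; apply: cvgB; apply: cvgMr.
  exact: continuous_coskx.
exact: continuous_sinkx.
Qed.

Lemma continuous_trigsum_from al be m n :
  continuous (fun x : R => \sum_(m <= k < n) trig al be k x).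
Proof.
move=> x; rewrite [X in continuous_at _ X](_ : _ =
  \sum_(m <= k < n) trig al be k); last by apply/funext => y; rewrite fct_sumE.
elim/big_ind : _ => [|f g cf cg|k _]; [exact: cvg_cst|exact: cvgD|].
exact: continuous_trig.
Qed.

Lemma continuous_trigsum al be n : continuous (trigsum al be n).
Proof. exact: continuous_trigsum_from. Qed.

Lemma cosD4pi k x : cos (k%:R * (x + 4 * pi)) = cos (k%:R * x) :> R.
Proof.
rewrite -[RHS](periodicn (@cosD2pi R) (k * 2)); congr cos.
by rewrite -mulrnA -[pi *+ _]mulr_natr !natrM; ring.
Qed.

Lemma sinD4pi k x : sin (k%:R * (x + 4 * pi)) = sin (k%:R * x) :> R.
Proof.
rewrite -[RHS](periodicn (@sinD2pi R) (k * 2)); congr sin.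
by rewrite -mulrnA -[pi *+ _]mulr_natr !natrM; ring.
Qed.

Lemma pi_lt3pi : - pi < 3 * pi :> R.
Proof. have := pi_gt0 R; lra. Qed.

(** The terms are eigenfunctions of the second derivative for the eigenvalues
[- j^2] and [- k^2], so their product is, up to the factor [j^2 - k^2], the
derivative of their Wronskian, which is periodic. *)
Lemma trig_orthogonal al be j k : j != k ->
  \int[mu]_(x in I) (trig al be j x * trig al be k x) = 0.
Proof.
move=> jk.
pose D l x := - (l%:R * (al l * sin (l%:R * x) + be l * cos (l%:R * x))).
pose c : R := j%:R ^+ 2 - k%:R ^+ 2.
have c0 : c != 0.
  rewrite /c subr_eq0; apply/negP => /eqP h.
  have := @pexpIrn R 2 isT j%:R k%:R; rewrite !nnegrE !ler0n => /(_ isT isT h).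
  by move/eqP; rewrite eqr_nat (negbTE jk).
(* Wronskian of the two terms *)
pose W x := c^-1 * (trig al be j x * D k x - D j x * trig al be k x).
have dtrig l (x : R) : is_derive x (1 : R) (trig al be l) (D l x).
  have h1 := is_derive_coskx l%:R x; have h2 := is_derive_sinkx l%:R x.
  by rewrite /trig; apply: is_derive_eq; rewrite /D /GRing.scale /=; ring.
have dD l (x : R) : is_derive x (1 : R) (D l) (- (l%:R ^+ 2 * trig al be l x)).
  have h1 := is_derive_coskx l%:R x; have h2 := is_derive_sinkx l%:R x.
  by rewrite /D; apply: is_derive_eq; rewrite /trig /GRing.scale /=; ring.
have dW (x : R) : is_derive x (1 : R) W (trig al be j x * trig al be k x).
  have := dtrig j x; have := dtrig k x; have := dD j x; have := dD k x.
  move=> h1 h2 h3 h4; rewrite /W; apply: is_derive_eq; rewrite /GRing.scale /=.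
  by rewrite /c; field.
rewrite /I /period2 (Rintegral_derive pi_lt3pi dW); last first.
  by move=> x; apply: cvgM; exact: continuous_trig.
have -> : 3 * pi = - pi + 4 * pi :> R by ring.
by rewrite /W /D /trig !cosD4pi !sinD4pi subrr.
Qed.

End trig.

Section trigL2.
Context (R : realType).
Local Notation mu := (@lebesgue_measure R).
Implicit Types (al be : nat -> R) (k : nat) (x : R).
Let I := @period2 R.

Let cI (f : R -> R) : continuous f -> mu.-integrable I (EFin \o f).
Proof. exact: continuous_itv_integrable. Qed.

Let mI : measurable I. Proof. exact: measurable_itv. Qed.

Lemma trigsum_orthogonal al be m p l : (m + p <= l)%N ->
  \int[mu]_(x in I) ((\sum_(m <= k < m + p) trig al be k x) * trig al be l x) = 0.
Proof.
elim: p => [|p IH] ml.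
  under eq_Rintegral do rewrite addn0 big_geq // mul0r.
  by rewrite Rintegral_cst // mul0r.
under eq_Rintegral do rewrite addnS big_nat_recr /= ?leq_addr // mulrDl.
rewrite RintegralD //.
- by rewrite IH ?trig_orthogonal ?addr0 ?(leq_trans _ ml) ?addnS //; lia.
- apply: cI => x; apply: cvgM; last exact: continuous_trig.
  exact: continuous_trigsum_from.
- by apply: cI => x; apply: cvgM; exact: continuous_trig.
Qed.

Lemma sqr_trig_le al be k x : trig al be k x ^+ 2 <= al k ^+ 2 + be k ^+ 2.
Proof.
rewrite /trig; set c := cos _; set s := sin _.
have h : c ^+ 2 + s ^+ 2 = 1 := cos2Dsin2 _.
rewrite -subr_ge0.
have -> : al k ^+ 2 + be k ^+ 2 - (al k * c - be k * s) ^+ 2 =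
   (al k * s + be k * c) ^+ 2 + (al k ^+ 2 + be k ^+ 2) * (1 - (c ^+ 2 + s ^+ 2)).
  by ring.
by rewrite h subrr mulr0 addr0 sqr_ge0.
Qed.

Lemma Rintegral_cst_period2 (c : R) : \int[mu]_(x in I) c = 4 * pi * c.
Proof.
rewrite /I /period2 Rintegral_cst_itv ?pi_lt3pi //; by ring.
Qed.

Lemma trigsum_L2_le al be m p :
  \int[mu]_(x in I) ((\sum_(m <= k < m + p) trig al be k x) ^+ 2) <=
  4 * pi * \sum_(m <= k < m + p) (al k ^+ 2 + be k ^+ 2).
Proof.
elim: p => [|p IH].
  under eq_Rintegral do rewrite addn0 big_geq // expr0n /=.
  by rewrite addn0 big_geq // Rintegral_cst // mul0r mulr0.
have cS := @continuous_trigsum_from R al be m (m + p).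
have ct := @continuous_trig R al be (m + p)%N.
under eq_Rintegral do rewrite addnS big_nat_recr /= ?leq_addr // sqrrD.
rewrite RintegralD //; last 2 first.
- apply: cI => x; apply: cvgD; first by apply: cvgM; exact: cS.
  by apply: cvgD; apply: cvgM => //; [exact: cS|exact: ct|exact: cS|exact: ct].
- by apply: cI => x; apply: cvgM; exact: ct.
rewrite RintegralD //; last 2 first.
- by apply: cI => x; apply: cvgM; exact: cS.
- apply: cI => x.
  by apply: cvgD; apply: cvgM => //; [exact: cS|exact: ct|exact: cS|exact: ct].
rewrite addnS big_nat_recr /= ?leq_addr // mulrDr.
have -> : \int[mu]_(x in I) ((\sum_(m <= k < m + p) trig al be k x) * trig al be (m + p) x *+ 2) = 0.
  under eq_Rintegral do rewrite -mulr_natr.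
  rewrite RintegralZr //; first by rewrite trigsum_orthogonal ?mul0r.
  by apply: cI => x; apply: cvgM; [exact: cS|exact: ct].
rewrite addr0; apply: lerD => //.
apply: (@le_trans _ _ (\int[mu]_(x in I) (al (m + p)%N ^+ 2 + be (m + p)%N ^+ 2))).
  apply: le_Rintegral => //.
  - by apply: cI => x; apply: cvgM; exact: ct.
  - by apply: cI => x; exact: cvg_cst.
  - by move=> x _; exact: sqr_trig_le.
by rewrite Rintegral_cst_period2.
Qed.

(** An L2 bound gives an L1 bound through [|S| <= e / 2 + S^2 / (2 e)]. *)
Lemma trigsum_L1_le al be m p (e : R) : 0 < e ->
  \sum_(m <= k < m + p) (al k ^+ 2 + be k ^+ 2) <= e ^+ 2 ->
  (\int[mu]_(x in I) `|(\sum_(m <= k < m + p) trig al be k x)%:E| <= (4 * pi * e)%:E)%E.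
Proof.
move=> e0 he.
have cS := @continuous_trigsum_from R al be m (m + p).
set S := fun x => \sum_(m <= k < m + p) trig al be k x.
have cS2 : continuous (fun x => S x ^+ 2) by move=> x; apply: cvgM; exact: cS.
pose B x := 2^-1 * e + (2 * e)^-1 * S x ^+ 2.
have cB : continuous B.
  by move=> x; apply: cvgD; [exact: cvg_cst|apply: cvgMr; exact: cS2].
have iB := cI cB.
apply: (@le_trans _ _ (\int[mu]_(x in I) (B x)%:E)%E).
  apply: ge0_le_integral => //.
  - apply: measurableT_comp => //; exact: (measurable_int mu (cI cS)).
  - exact: (measurable_int mu iB).
  - move=> x _; rewrite lee_fin -subr_ge0.
    have -> : B x - `|S x| = (2 * e)^-1 * (`|S x| - e) ^+ 2.
      rewrite /B -[S x ^+ 2]real_normK ?num_real //; field.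
      by rewrite gt_eqF.
    by rewrite mulr_ge0 ?invr_ge0 ?sqr_ge0 // mulr_ge0 // ltW.
have -> : (\int[mu]_(x in I) (B x)%:E = (\int[mu]_(x in I) B x)%:E)%E.
  by rewrite fineK //; exact: integrable_fin_num.
rewrite lee_fin /B RintegralD //; last 2 first.
- by apply: cI => x; exact: cvg_cst.
- by apply: cI => x; apply: cvgMr; exact: cS2.
rewrite Rintegral_cst_period2 RintegralZl //; last exact: cI.
have h := le_trans (trigsum_L2_le al be m p) (ler_wpM2l _ he).
have p0 := pi_gt0 R.
have {}h : \int[mu]_(x in I) S x ^+ 2 <= 4 * pi * e ^+ 2.
  by apply: h; rewrite mulr_ge0 // ltW.
apply: (@le_trans _ _ (4 * pi * (2^-1 * e) + (2 * e)^-1 * (4 * pi * e ^+ 2))).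
  by rewrite lerD2l ler_wpM2l // invr_ge0 mulr_ge0 // ltW.
have -> : 4 * pi * (2^-1 * e) + (2 * e)^-1 * (4 * pi * e ^+ 2) = 4 * pi * e :> R.
  by field; rewrite gt_eqF.
exact: lexx.
Qed.

(** The tails of the sum of squares bound the L1 distances of the partial sums. *)
Lemma trigsum_L1_cvg al be :
  cvgn (series (fun k => al k ^+ 2 + be k ^+ 2)) ->
  exists g : R -> R, mu.-integrable I (EFin \o g) /\
    forall e : R, 0 < e -> exists N, forall n, (N <= n)%N ->
      (\int[mu]_(x in I) `|(trigsum al be n x - g x)%:E| <= e%:E)%E.
Proof.
move=> hc; apply: (@L1_complete _ _ R mu I (trigsum al be) mI).
  by move=> n; apply: cI; exact: continuous_trigsum.
move=> e e0.
have p0 := pi_gt0 R.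
pose e1 := e / (4 * pi).
have e10 : 0 < e1 by rewrite divr_gt0 // mulr_gt0.
have e2 : 0 < e1 ^+ 2 by rewrite exprn_gt0.
have hcau := proj1 (@cauchy_seriesP R R^o (fun k => al k ^+ 2 + be k ^+ 2)) (cvg_cauchy _ hc).
have [[A B] /= [[N1 _ N1A] [N2 _ N2B]] NP] := hcau _ _ e2.
pose N := maxn N1 N2; exists N.
have main m n : (N <= m)%N -> (m <= n)%N ->
  (\int[mu]_(x in I) `|(trigsum al be n x - trigsum al be m x)%:E| <= e%:E)%E.
  move=> Nm mn.
  have -> : e = 4 * pi * e1 by rewrite /e1 mulrC divfK // gt_eqF // mulr_gt0.
  under eq_integral do rewrite /trigsum (big_cat_nat _ mn) //= [X in X - _]addrC addrK.
  rewrite -(subnKC mn); apply: trigsum_L1_le => //.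
  rewrite subnKC //.
  have := NP (m, n); rewrite /= => H; apply/ltW/(le_lt_trans (ler_norm _))/H.
  split; first by apply: N1A => /=; lia.
  by apply: N2B => /=; lia.
move=> m n Nm Nn.
have [mn|nm] := leqP n m; first exact: main.
apply: le_trans (main _ _ Nm (ltnW nm)); rewrite le_eqVlt; apply/orP; left; apply/eqP.
by apply: eq_integral => x _; rewrite !abse_EFin distrC.
Qed.
End trigL2.

(** * The Poisson kernel *)

Section poisson.
Context (R : realType).
Local Notation mu := (@lebesgue_measure R).
Variable r : R.
Hypotheses (r0 : 0 < r) (r1 : r < 1).

Definition poisson_den (h : R) := 1 - 2 * r * cos h + r ^+ 2.
Definition poisson (h : R) := (1 - r ^+ 2) / poisson_den h.
(** Minus the derivative of [poisson r]. *)
Definition poisson' (h : R) := 2 * r * (1 - r ^+ 2) * sin h / poisson_den h ^+ 2.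

Lemma poisson_den_ge h : 2 * r * (1 - cos h) <= poisson_den h.
Proof.
have -> : poisson_den h = (1 - r) ^+ 2 + 2 * r * (1 - cos h) by rewrite /poisson_den; ring.
by rewrite lerDr sqr_ge0.
Qed.

Lemma poisson_den_gt0 h : 0 < poisson_den h.
Proof.
have -> : poisson_den h = (1 - r) ^+ 2 + 2 * r * (1 - cos h) by rewrite /poisson_den; ring.
apply: ltr_pwDl; first by rewrite exprn_gt0 // subr_gt0.
by rewrite mulr_ge0 ?mulr_ge0 ?(ltW r0) // subr_ge0 cos_le1.
Qed.

Lemma is_derive_poisson (h : R) : is_derive h (1 : R) poisson (- poisson' h).
Proof.
have d0 : poisson_den h != 0 by rewrite gt_eqF // poisson_den_gt0.
have dd : is_derive h (1 : R) poisson_den (2 * r * sin h).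
  have := is_derive_cos h => h1.
  by rewrite /poisson_den; apply: is_derive_eq; rewrite /GRing.scale /=; ring.
have dv := is_deriveV d0 dd.
rewrite /poisson; apply: is_derive_eq; rewrite /GRing.scale /= /poisson'.
by field.
Qed.

Lemma continuous_poisson : continuous poisson.
Proof.
by move=> h; apply/differentiable_continuous/derivable1_diffP; case: (is_derive_poisson h).
Qed.

Lemma continuous_poisson' : continuous poisson'.
Proof.
move=> h; have d0 : poisson_den h != 0 by rewrite gt_eqF // poisson_den_gt0.
have cd : {for h, continuous poisson_den}.
  apply: cvgD; last exact: cvg_cst.
  by apply: cvgB; [exact: cvg_cst|apply: cvgMr; exact: continuous_cos].
apply: cvgM; first by apply: cvgMr; exact: continuous_sin.
apply: cvgV; first by rewrite expf_neq0.
by apply: cvgM.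
Qed.

Let J k := \int[mu]_(h in `[0, pi]) (cos (k%:R * h) * poisson h).

Let cJ k : continuous (fun h : R => cos (k%:R * h) * poisson h).
Proof.
by move=> h; apply: cvgM; [exact: continuous_coskx|exact: continuous_poisson].
Qed.

(* integrability facts that close side conditions from the context *)
Let iJ k : mu.-integrable `[0, pi] (EFin \o (fun h : R => cos (k%:R * h) * poisson h)).
Proof. exact: continuous_itv_integrable. Qed.

Lemma Rintegral_cos_0pi (k : nat) :
  \int[mu]_(h in `[0, pi]) cos (k%:R * h) = if k is 0%N then pi else 0 :> R.
Proof.
case: k => [|k].
  under eq_Rintegral do rewrite mul0r cos0.
  by rewrite Rintegral_cst_itv ?pi_gt0 // mul1r subr0.
have k0 : k.+1%:R != 0 :> R by rewrite pnatr_eq0.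
have dS (h : R) : is_derive h (1 : R) (fun h => k.+1%:R^-1 * sin (k.+1%:R * h)) (cos (k.+1%:R * h)).
  have h1 := is_derive_sinkx k.+1%:R h.
  by apply: is_derive_eq; rewrite /GRing.scale /=; field.
rewrite (Rintegral_derive (pi_gt0 R) dS); last by move=> x; exact: continuous_coskx.
rewrite mulr0 sin0 mulr0 subr0.
by rewrite sin_natpi mulr0.
Qed.

Let ic k : mu.-integrable `[0, pi] (EFin \o (fun h : R => cos (k%:R * h))).
Proof. by apply: continuous_itv_integrable => x; exact: continuous_coskx. Qed.

Let icZ c k : mu.-integrable `[0, pi] (EFin \o (fun h : R => c * cos (k%:R * h))).
Proof.
by apply: continuous_itv_integrable => x; apply: cvgMr; exact: continuous_coskx.
Qed.

Let iJZ c k : mu.-integrable `[0, pi] (EFin \o (fun h : R => c * (cos (k%:R * h) * poisson h))).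
Proof. by apply: continuous_itv_integrable => x; apply: cvgMr; exact: cJ. Qed.

Let J_rec k : (1 + r ^+ 2) * J k.+1 = r * J k.+2 + r * J k.
Proof.
have H h : (1 + r ^+ 2) * (cos (k.+1%:R * h) * poisson h) =
  r * (cos (k.+2%:R * h) * poisson h) + r * (cos (k%:R * h) * poisson h) +
  (1 - r ^+ 2) * cos (k.+1%:R * h).
  have d0 : poisson_den h != 0 by rewrite gt_eqF // poisson_den_gt0.
  have E : cos (k.+2%:R * h) + cos (k%:R * h) = 2 * cos (k.+1%:R * h) * cos h.
    have -> : k.+2%:R * h = k.+1%:R * h + h by rewrite -[k.+2%:R]natr1; ring.
    have -> : k%:R * h = k.+1%:R * h - h by rewrite -[k.+1%:R]natr1; ring.
    by rewrite cosD cosB; ring.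
  have {E} -> := canRL (addrK _) E; rewrite /poisson.
  by move: d0; rewrite /poisson_den => d0; field.
rewrite /J -!RintegralZl //; under eq_Rintegral do rewrite H.
rewrite RintegralD //; last first.
  by apply: continuous_itv_integrable => x; apply: cvgD; apply: cvgMr; exact: cJ.
by rewrite RintegralD // [X in _ + X = _]RintegralZl // Rintegral_cos_0pi mulr0 addr0.
Qed.

Let J_0 : (1 + r ^+ 2) * J 0 = 2 * r * J 1 + (1 - r ^+ 2) * pi.
Proof.
have H h : (1 + r ^+ 2) * (cos (0%:R * h) * poisson h) =
  2 * r * (cos (1%:R * h) * poisson h) + (1 - r ^+ 2) * cos (0%:R * h).
  have d0 : poisson_den h != 0 by rewrite gt_eqF // poisson_den_gt0.
  rewrite mul0r cos0 !mul1r mulr1 /poisson.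
  by move: d0; rewrite /poisson_den => d0; field.
rewrite /J -!RintegralZl //; under eq_Rintegral do rewrite H.
by rewrite RintegralD // [X in _ + X]RintegralZl // Rintegral_cos_0pi.
Qed.

Let J_bound k : `|J k| <= pi * ((1 - r ^+ 2) / (1 - r) ^+ 2).
Proof.
have r1' : 0 < 1 - r by rewrite subr_gt0.
have r2 : 0 < 1 - r ^+ 2 by rewrite subr_gt0 expr_lt1 // ltW.
apply: (le_trans (le_normr_Rintegral _ _)) => //.
apply: (@le_trans _ _ (\int[mu]_(h in `[0, pi]) ((1 - r ^+ 2) / (1 - r) ^+ 2))).
  apply: le_Rintegral => //.
  - apply: continuous_itv_integrable => x.
    by apply: cvg_norm; exact: cJ.
  - by apply: continuous_itv_integrable => x; exact: cvg_cst.
  - move=> h _; rewrite normrM -[leRHS]mul1r ler_pM ?cos_max //.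
    rewrite /poisson normrM !gtr0_norm ?invr_gt0 ?poisson_den_gt0 //.
    rewrite ler_wpM2l ?(ltW r2) // lef_pV2 ?posrE ?poisson_den_gt0 ?exprn_gt0 //.
    have -> : poisson_den h = (1 - r) ^+ 2 + 2 * r * (1 - cos h).
      by rewrite /poisson_den; ring.
    by rewrite lerDl mulr_ge0 ?mulr_ge0 ?(ltW r0) // subr_ge0 cos_le1.
by rewrite Rintegral_cst_itv ?pi_gt0 // subr0 mulrC.
Qed.

(** The moments satisfy a two-step recurrence with solutions [r^k] and [r^-k];
boundedness of the moments excludes the second. *)
Lemma Rintegral_cos_poisson k :
  \int[mu]_(h in `[0, pi]) (cos (k%:R * h) * poisson h) = pi * r ^+ k.
Proof.
rewrite -/(J k).
(* [e] isolates the growing solution: [e 0 = r ^+ j * e j] for all [j] *)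
pose e k := J k.+1 - r * J k.
have e_rec j : e j = r * e j.+1.
  by have := J_rec j; rewrite /e => h; lra.
have e_0 j : e 0 = r ^+ j * e j.
  by elim: j => [|j ->]; rewrite ?expr0 ?mul1r // e_rec mulrA -exprSr.
pose C := pi * ((1 - r ^+ 2) / (1 - r) ^+ 2).
have e_bound j : `|e j| <= C + r * C.
  apply: (le_trans (ler_normB _ _)); rewrite lerD ?J_bound // normrM gtr0_norm //.
  by rewrite ler_wpM2l ?J_bound // ltW.
have e00 : e 0 = 0.
  apply/eqP; rewrite -normr_le0; apply/ler_addgt0Pr => d d0; rewrite add0r.
  have : (fun j => r ^+ j * (C + r * C)) @ \oo --> (0 : R).
    rewrite -[X in _ --> X](mul0r (C + r * C)); apply: cvgMl.
    by apply: cvg_expr; rewrite gtr0_norm.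
  move=> /cvgrPdist_le /(_ _ d0) [j _ /(_ j (leqnn _))].
  rewrite sub0r normrN => /(le_trans (ler_norm _)); apply: le_trans.
  by rewrite (e_0 j) normrM gtr0_norm ?exprn_gt0 // ler_wpM2l // exprn_ge0 // ltW.
have eJ j : J j.+1 = r * J j.
  suff : e j = 0 by rewrite /e => /subr0_eq.
  elim: j => // j IH; move: (e_rec j); rewrite IH => /esym/eqP.
  by rewrite mulf_eq0 gt_eqF //= => /eqP.
have J0 : J 0 = pi.
  have h := J_0; rewrite eJ in h.
  have : (1 - r ^+ 2) * (J 0 - pi) = 0 by move: h; set a := J 0; lra.
  have r2 : 0 < 1 - r ^+ 2 by rewrite subr_gt0 expr_lt1 // ltW.
  by move/eqP; rewrite mulf_eq0 gt_eqF //= => /eqP/subr0_eq.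
by elim: k => [|k IH]; rewrite ?expr0 ?mulr1 // eJ IH exprS; ring.
Qed.
End poisson.

(** The primitive of [cos (k h)] that vanishes at 0. *)
Definition prim_cos (R : realType) (k : nat) (h : R) : R :=
  if k is 0%N then h else sin (k%:R * h) / k%:R.

Section abel.
Context (R : realType).
Local Notation mu := (@lebesgue_measure R).
Implicit Types (al be : nat -> R) (k : nat).

Lemma is_derive_prim_cos k (h : R) : is_derive h (1 : R) (@prim_cos R k) (cos (k%:R * h)).
Proof.
case: k => [|k]; first by rewrite mul0r cos0; exact: is_derive_id.
have k0 : k.+1%:R != 0 :> R by rewrite pnatr_eq0.
have h1 := is_derive_sinkx k.+1%:R h.
have H : is_derive h (1 : R) (fun h => k.+1%:R^-1 * sin (k.+1%:R * h)) (cos (k.+1%:R * h)).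
  by apply: is_derive_eq; rewrite /GRing.scale /=; field.
rewrite [X in is_derive _ _ X _](_ : _ = (fun h => k.+1%:R^-1 * sin (k.+1%:R * h))) //.
by apply/funext => x; rewrite /prim_cos mulrC.
Qed.

Lemma continuous_prim_cos k : continuous (@prim_cos R k).
Proof.
by move=> h; apply/differentiable_continuous/derivable1_diffP; case: (is_derive_prim_cos k h).
Qed.

Lemma prim_cos0 k : prim_cos k 0 = 0 :> R.
Proof. by case: k => [//|k]; rewrite /prim_cos mulr0 sin0 mul0r. Qed.

Lemma prim_cos_pi k : prim_cos k pi = if k is 0%N then pi else 0 :> R.
Proof. by case: k => [//|k]; rewrite /prim_cos sin_natpi mul0r. Qed.

(** Integration by parts. *)
Lemma Rintegral_prim_cos_poisson' (r : R) k : 0 < r -> r < 1 ->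
  \int[mu]_(h in `[0, pi]) (prim_cos k h * poisson' r h) =
  pi * r ^+ k - prim_cos k pi * poisson r pi.
Proof.
move=> r0 r1.
have cP := continuous_poisson r0 r1; have cP' := continuous_poisson' r0 r1.
have dF (h : R) : is_derive h (1 : R) (fun h => prim_cos k h * poisson r h)
    (cos (k%:R * h) * poisson r h - prim_cos k h * poisson' r h).
  have h1 := is_derive_prim_cos k h; have h2 := is_derive_poisson r0 r1 h.
  by apply: is_derive_eq; rewrite /GRing.scale /=; ring.
have cA : continuous (fun h : R => cos (k%:R * h) * poisson r h).
  by move=> h; apply: cvgM; [exact: continuous_coskx|exact: cP].
have cB : continuous (fun h : R => prim_cos k h * poisson' r h).
  by move=> h; apply: cvgM; [exact: continuous_prim_cos|exact: cP'].
have := Rintegral_derive (pi_gt0 R) dF.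
rewrite prim_cos0 mul0r subr0 RintegralB //; try exact: continuous_itv_integrable.
rewrite Rintegral_cos_poisson // => H.
rewrite -[in RHS]H; first by ring.
by move=> x; apply: cvgB; [exact: cA|exact: cB].
Qed.

Definition sym_prim al be (t : R) n (h : R) :=
  \sum_(0 <= k < n) trig al be k t * prim_cos k h.

(** By the addition formulas, a primitive of a term grows from [t - h] to [t + h] by
twice the value of the term at [t] times [prim_cos k h]. *)
Lemma sym_primE al be (t : R) n (h : R) : 0 < h ->
  \int[mu]_(x in `[t - h, t + h]) trigsum al be n x = 2 * sym_prim al be t n h.
Proof.
move=> h0; have th : t - h < t + h by rewrite ltrD2l gtrN.
have cT k : mu.-integrable `[t - h, t + h] (EFin \o trig al be k).
  by apply: continuous_itv_integrable; exact: continuous_trig.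
have cS k : mu.-integrable `[t - h, t + h] (EFin \o trigsum al be k).
  by apply: continuous_itv_integrable; exact: continuous_trigsum.
elim: n => [|n IH].
  rewrite /sym_prim big_geq // mulr0.
  under eq_Rintegral do rewrite /trigsum big_geq //.
  by rewrite Rintegral_cst // mul0r.
rewrite /sym_prim big_nat_recr //= mulrDr -/(sym_prim _ _ _ _ _) -IH.
transitivity (\int[mu]_(x in `[t - h, t + h]) (trigsum al be n x + trig al be n x)).
  by apply: eq_Rintegral => x _; rewrite /trigsum big_nat_recr.
rewrite RintegralD //; congr (_ + _).
(* [F] is a primitive of the term; a term of index 0 has no sine part *)
pose F x := al n * prim_cos n x + be n * (if n is 0%N then 0 else cos (n%:R * x) / n%:R).
have dF (x : R) : is_derive x (1 : R) F (trig al be n x).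
  have h1 := is_derive_prim_cos n x.
  have h2 : is_derive x (1 : R) (fun x => if n is 0%N then 0 else cos (n%:R * x) / n%:R)
      (- sin (n%:R * x)).
    case: (n) => [|k]; first by rewrite mul0r sin0 oppr0; exact: is_derive_cst.
    have k0 : k.+1%:R != 0 :> R by rewrite pnatr_eq0.
    have h3 := is_derive_coskx k.+1%:R x.
    under eq_fun do rewrite mulrC.
    by apply: is_derive_eq; rewrite /GRing.scale /=; field.
  by rewrite /F; apply: is_derive_eq; rewrite /trig /GRing.scale /=; ring.
rewrite (Rintegral_derive th dF); last exact: continuous_trig.
rewrite /F /trig; case: (n) => [|k]; first by rewrite mul0r cos0 sin0 /prim_cos; ring.
have k0 : k.+1%:R != 0 :> R by rewrite pnatr_eq0.
rewrite /prim_cos !mulrDr !mulrN !cosD !sinD !cosN !sinN.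

by field.
Qed.

Lemma poisson'_ge0 (r h : R) : 0 < r -> r < 1 -> 0 <= h <= pi -> 0 <= poisson' r h.
Proof.
move=> r0 r1 hpi; rewrite /poisson' divr_ge0 ?exprn_ge0 ?(ltW (poisson_den_gt0 r0 r1 h)) //.
rewrite mulr_ge0 ?sin_ge0_pi // mulr_ge0 ?mulr_ge0 ?(ltW r0) //.
by rewrite subr_ge0 exprn_ile1 // ltW.
Qed.

Lemma poisson'_le (r d h : R) : 2^-1 <= r -> r < 1 -> 0 < d -> d <= h -> h <= pi ->
  poisson' r h <= 4 * (1 - r) / (1 - cos d) ^+ 2.
Proof.
move=> r2 r1 d0 dh hpi.
have r0 : 0 < r by apply: lt_le_trans r2; rewrite invr_gt0.
have h0 : 0 <= h by rewrite (le_trans (ltW d0)).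
have dpi : d <= pi by rewrite (le_trans dh).
have inpi x : 0 <= x -> x <= pi -> x \in `[0, pi]%R by rewrite in_itv /= => -> ->.
have cd : cos d < 1.
  by rewrite -(@cos0 R) ltr_cos // inpi // ?pi_ge0 // ltW.
have chd : cos h <= cos d.
  move: dh; rewrite le_eqVlt => /predU1P[->//|dh].
  by rewrite ltW // ltr_cos // inpi // ltW.
have k0 : 0 < 1 - cos d by rewrite subr_gt0.
have kd : 1 - cos d <= poisson_den r h.
  apply: le_trans (poisson_den_ge r h).
  apply: (@le_trans _ _ (1 * (1 - cos h))); first by rewrite mul1r; lra.
  by rewrite ler_wpM2r ?subr_ge0 ?cos_le1 //; lra.
rewrite /poisson'; apply: ler_pM.
- rewrite mulr_ge0 ?sin_ge0_pi ?h0 // mulr_ge0 ?mulr_ge0 ?(ltW r0) //.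
  by rewrite subr_ge0 exprn_ile1 // ltW.
- by rewrite invr_ge0 exprn_ge0 // ltW // poisson_den_gt0.
- apply: (@le_trans _ _ (2 * r * (1 - r ^+ 2) * 1)).
    rewrite ler_wpM2l ?sin_le1 // mulr_ge0 ?mulr_ge0 ?(ltW r0) //.
    by rewrite subr_ge0 exprn_ile1 // ltW.
  have -> : 2 * r * (1 - r ^+ 2) * 1 = 2 * (r * (1 + r)) * (1 - r) by ring.
  rewrite ler_wpM2r ?subr_ge0 ?(ltW r1) //; nra.
- rewrite lef_pV2 ?posrE ?exprn_gt0 ?poisson_den_gt0 //.
  by rewrite lerXn2r // nnegrE ltW // poisson_den_gt0.
Qed.

End abel.

(** * Abel means at a point of differentiability of the primitive *)

Section fatou.
Context (R : realType).
Local Notation mu := (@lebesgue_measure R).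
Implicit Types (al be : nat -> R) (k : nat).

Definition abel_sum al be (t r : R) n := \sum_(0 <= k < n) trig al be k t * r ^+ k.

Lemma continuous_sym_prim al be (t : R) n : continuous (sym_prim al be t n).
Proof.
move=> x; rewrite [X in continuous_at _ X](_ : _ =
  \sum_(0 <= k < n) (fun h => trig al be k t * prim_cos k h)); last first.
  by apply/funext => y; rewrite fct_sumE.
elim/big_ind : _ => [|f g cf cg|k _]; [exact: cvg_cst|exact: cvgD|].
by apply: cvgMr; exact: continuous_prim_cos.
Qed.

Lemma Rintegral_sym_prim_poisson' al be (t r : R) n : 0 < r -> r < 1 ->
  \int[mu]_(h in `[0, pi]) (sym_prim al be t n.+1 h * poisson' r h) =
  pi * (abel_sum al be t r n.+1 - al 0%N * poisson r pi).
Proof.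
move=> r0 r1; have cP' := continuous_poisson' r0 r1.
have cS m : continuous (fun h => sym_prim al be t m h * poisson' r h).
  by move=> h; apply: cvgM; [exact: continuous_sym_prim|exact: cP'].
have ct m : continuous (fun h => trig al be m t * (prim_cos m h * poisson' r h)).
  by move=> h; apply: cvgMr; apply: cvgM; [exact: continuous_prim_cos|exact: cP'].
have cp m : continuous (fun h => prim_cos m h * poisson' r h).
  by move=> h; apply: cvgM; [exact: continuous_prim_cos|exact: cP'].
elim: n => [|n IH].
  transitivity (\int[mu]_(h in `[0, pi]) (trig al be 0 t * (prim_cos 0 h * poisson' r h))).
    by apply: eq_Rintegral => x _; rewrite /sym_prim big_nat1 mulrA.
  rewrite RintegralZl //; last exact: continuous_itv_integrable.
  rewrite Rintegral_prim_cos_poisson' // prim_cos_pi /abel_sum big_nat1 expr0.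
  by rewrite /trig !mul0r cos0 sin0; ring.
transitivity (\int[mu]_(h in `[0, pi]) (sym_prim al be t n.+1 h * poisson' r h +
    trig al be n.+1 t * (prim_cos n.+1 h * poisson' r h))).
  by apply: eq_Rintegral => x _; rewrite /sym_prim big_nat_recr // mulrDl mulrA.
rewrite RintegralD //; try exact: continuous_itv_integrable.
rewrite IH RintegralZl //; last exact: continuous_itv_integrable.
rewrite Rintegral_prim_cos_poisson' // prim_cos_pi /abel_sum [in RHS]big_nat_recr //=.
by ring.
Qed.

Lemma weighted_error_le (G S L h Q eta eps M K : R) :
  0 <= Q -> 0 <= h -> 0 <= eps -> 0 <= M -> 0 <= K -> `|S - G| <= eta ->
  `|G - L * h| <= eps * h \/ `|G - L * h| <= M /\ Q <= K ->
  `|S * Q - L * (h * Q)| <= eta * Q + eps * (h * Q) + M * K.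
Proof.
move=> Q0 h0 eps0 M0 K0 SG cases.
rewrite mulrA -mulrBl normrM (ger0_norm Q0).
apply: (@le_trans _ _ ((eta + `|G - L * h|) * Q)).
  rewrite ler_wpM2r // -(subrKA G); apply: (le_trans (ler_normD _ _)).
  by rewrite lerD2r.
rewrite mulrDl -addrA lerD2l.
case: cases => [Gh|[GM QK]].
  by rewrite -[leLHS]addr0 lerD ?mulr_ge0 // mulrA ler_wpM2r.
by rewrite -[leLHS]add0r lerD ?mulr_ge0 // ler_pM.
Qed.

(** Integrating by parts, the Abel sum is the integral of [sym_prim] against
[pi^-1 * poisson'], up to a boundary term at [pi]. As [poisson'] is nonnegative
and [h * poisson' r h] has integral at most [pi], an error [eps * h] near 0 costs
at most [eps]; away from 0 the kernel itself is small when [r] is close to 1. *)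
Lemma abel_sum_estimate al be (t L r eta eps d M : R) (G : R -> R) n :
  2^-1 <= r -> r < 1 -> 0 <= eta -> 0 <= eps -> 0 < d -> 0 <= M ->
  (forall h, 0 <= h <= pi -> `|sym_prim al be t n.+1 h - G h| <= eta) ->
  (forall h, 0 <= h <= pi -> h <= d -> `|G h - L * h| <= eps * h) ->
  (forall h, 0 <= h <= pi -> `|G h - L * h| <= M) ->
  `|abel_sum al be t r n.+1 - (L * (1 - poisson r pi) + al 0%N * poisson r pi)| <=
  eta * (pi^-1 * \int[mu]_(h in `[0, pi]) poisson' r h) + eps +
  M * (4 * (1 - r) / (1 - cos d) ^+ 2).
Proof.
move=> r2 r1 eta0 eps0 d0 M0 HG Hsmall HM.
have r0 : 0 < r by apply: lt_le_trans r2; rewrite invr_gt0.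
have p0 := pi_gt0 R.
have cP' := continuous_poisson' r0 r1.
set K := 4 * (1 - r) / _.
have K0 : 0 <= K.
  by rewrite divr_ge0 ?sqr_ge0 // mulr_ge0 // subr_ge0 ltW.
have cS : continuous (fun h => sym_prim al be t n.+1 h * poisson' r h).
  by move=> h; apply: cvgM; [exact: continuous_sym_prim|exact: cP'].
have ch c : continuous (fun h : R => c * (prim_cos 0 h * poisson' r h)).
  by move=> h; apply: cvgMr; apply: cvgM; [exact: continuous_prim_cos|exact: cP'].
have ch1 : continuous (fun h : R => (prim_cos 0 h * poisson' r h)).
  by move=> h; apply: cvgM; [exact: continuous_prim_cos|exact: cP'].
have ce : continuous (fun h => eta * poisson' r h).
  by move=> h; apply: cvgMr; exact: cP'.
have cB : continuous (fun h => eta * poisson' r h + eps * (prim_cos 0 h * poisson' r h) + M * K).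
  by move=> h; apply: cvgD; [apply: cvgD; [exact: ce|exact: ch]|exact: cvg_cst].
(* the case [k = 0] normalizes the kernel [h * poisson' r h] *)
have I0 := @Rintegral_prim_cos_poisson' R r 0 r0 r1.
have E : pi * (abel_sum al be t r n.+1 - (L * (1 - poisson r pi) + al 0%N * poisson r pi)) =
  \int[mu]_(h in `[0, pi]) (sym_prim al be t n.+1 h * poisson' r h - L * (prim_cos 0 h * poisson' r h)).
  rewrite RintegralB //; try exact: continuous_itv_integrable.
  rewrite Rintegral_sym_prim_poisson' // RintegralZl //; last exact: continuous_itv_integrable.
  by rewrite I0 prim_cos_pi; ring.
have P0 : 0 < poisson r pi.
  by rewrite divr_gt0 ?poisson_den_gt0 // subr_gt0 exprn_ilt1 // ltW.
have pw (h : R) : 0 <= h <= pi ->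
    `|sym_prim al be t n.+1 h * poisson' r h - L * (prim_cos 0 h * poisson' r h)| <=
    eta * poisson' r h + eps * (prim_cos 0 h * poisson' r h) + M * K.
  move=> hpi; rewrite /prim_cos.
  have [h0 _] := andP hpi.
  apply: (@weighted_error_le (G h)) => //; first exact: poisson'_ge0.
    exact: HG.
  case: (leP h d) => hd; first by left; exact: Hsmall.
  by right; split; [exact: HM|apply: poisson'_le => //; [exact: ltW|case/andP: hpi]].
rewrite -(ler_pM2l p0) -[X in X * `|_|](gtr0_norm p0) -normrM E.
apply: (le_trans (le_normr_Rintegral _ _)) => //.
  by apply: continuous_itv_integrable => x; apply: cvgB; [exact: cS|exact: ch].
apply: (@le_trans _ _ (\int[mu]_(h in `[0, pi])
    (eta * poisson' r h + eps * (prim_cos 0 h * poisson' r h) + M * K))).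
  apply: le_Rintegral => //.
  - apply: continuous_itv_integrable => x; apply: cvg_norm.
    by apply: cvgB; [exact: cS|exact: ch].
  - exact: continuous_itv_integrable.
rewrite RintegralD //; try exact: continuous_itv_integrable.
- rewrite RintegralD //; try exact: continuous_itv_integrable.
  rewrite Rintegral_cst_itv ?pi_gt0 // subr0.
  rewrite !RintegralZl //; try exact: continuous_itv_integrable.
  rewrite I0 prim_cos_pi expr0 mulr1.
  have E' p Q : p != 0 -> p * (eta * (p^-1 * Q) + eps + M * K) = eta * Q + eps * p + M * K * p.
    by move=> p1; field.
  rewrite E' ?gt_eqF //.
  rewrite lerD2r lerD2l ler_wpM2l //.
  by rewrite gerBl mulr_ge0 // ltW.
- by apply: continuous_itv_integrable => h; apply: cvgD; [exact: ce|exact: ch].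
- by apply: continuous_itv_integrable => h; exact: cvg_cst.
Qed.

Lemma poisson_pi_cvg : poisson r pi @[r --> (1 : R)^'-] --> (0 : R).
Proof.
have E : \forall r \near (1:R)^'-, (1 - r) / (1 + r) = poisson r pi.
  near=> r; rewrite /poisson /poisson_den cospi.
  have r0 : 0 < r by near: r; apply: nbhs_left_gt.
  have : 1 + r != 0 by rewrite gt_eqF // addr_gt0.
  move=> h; field.
  by rewrite h (_ : _ + _ = (1 + r) ^+ 2) ?expf_neq0 //; ring.
apply: cvg_trans (near_eq_cvg E) _.
apply: cvg_at_left_filter.
rewrite -[X in _ --> X](_ : (1 - 1) / (1 + 1) = 0 :> R); last by rewrite subrr mul0r.
apply: cvgM; first by apply: cvgB; [exact: cvg_cst|exact: cvg_id].
apply: cvgV; first by rewrite gt_eqF // addr_gt0.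
by apply: cvgD; [exact: cvg_cst|exact: cvg_id].
Unshelve. all: by end_near. Qed.

(** Here [G h / h] is a symmetric difference quotient of the primitive at [t], and
[L] is its limit. Positivity of the kernel turns convergence of [G h / h] into
convergence of the Abel means. *)
Lemma abel_sum_cvg al be (t L M : R) (G u : R -> R) : 0 <= M ->
  (forall r, 0 < r < 1 -> abel_sum al be t r @ \oo --> u r) ->
  (forall eta, 0 < eta -> exists N, forall n, (N <= n)%N ->
     forall h, 0 <= h <= pi -> `|sym_prim al be t n h - G h| <= eta) ->
  (forall h, 0 <= h <= pi -> `|G h - L * h| <= M) ->
  (forall eps, 0 < eps -> exists2 d, 0 < d &
     forall h, 0 <= h <= pi -> h <= d -> `|G h - L * h| <= eps * h) ->
  u r @[r --> (1 : R)^'-] --> L.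
Proof.
move=> M0 hu HG HM Hsmall.
have step eps : 0 < eps -> exists2 K : R, 0 <= K & \forall r \near (1:R)^'-,
    `|u r - (L * (1 - poisson r pi) + al 0%N * poisson r pi)| <= eps + K * (1 - r).
  move=> eps0; have [d d0 Hd] := Hsmall _ eps0.
  exists (M * (4 / (1 - cos d) ^+ 2)); first by rewrite mulr_ge0 // divr_ge0 // sqr_ge0.
  near=> r.
  have r1 : r < 1 by near: r; exact: nbhs_left_lt.
  have r2 : 2^-1 <= r.
    by near: r; apply: nbhs_left_ge; rewrite invf_lt1 // ltr1n.
  have r0 : 0 < r by apply: lt_le_trans r2; rewrite invr_gt0.
  set C := pi^-1 * \int[mu]_(h in `[0, pi]) poisson' r h.
  have C0 : 0 <= C.
    rewrite mulr_ge0 ?invr_ge0 ?pi_ge0 // Rintegral_ge0 // => h.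
    rewrite /= in_itv /= => hh; exact: poisson'_ge0.
  apply/ler_addgt0Pr => e e0.
  (* for a fixed [r] the kernel has mass [pi * C], so this tolerance costs at most [e] *)
  pose eta := e / (C + 1).
  have eta0 : 0 < eta by rewrite divr_gt0 // ltr_wpDl.
  have [N HN] := HG _ eta0.
  have ru : abel_sum al be t r @ \oo --> u r by apply: hu; rewrite r0.
  have ru' : `|abel_sum al be t r n - (L * (1 - poisson r pi) + al 0%N * poisson r pi)| @[n --> \oo] -->
      `|u r - (L * (1 - poisson r pi) + al 0%N * poisson r pi)|.
    by apply: cvg_norm; apply: cvgB => //; exact: cvg_cst.
  rewrite -(cvg_lim _ ru') //; apply: limr_le; first by apply/cvg_ex; eexists; exact: ru'.
  exists N.+1 => // n /=; case: n => // n Nn.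
  have := @abel_sum_estimate al be t L r eta eps d M G n r2 r1 (ltW eta0) (ltW eps0) d0 M0
    (HN n.+1 (ltnW Nn)) Hd HM.
  move=> /le_trans; apply; rewrite -/C.
  have -> : M * (4 * (1 - r) / (1 - cos d) ^+ 2) = M * (4 / (1 - cos d) ^+ 2) * (1 - r) by ring.
  have etaC : eta * C <= e.
    by rewrite /eta mulrAC ler_pdivrMr ?ltr_wpDl // ler_wpM2l ?(ltW e0) //; lra.
  by move: etaC; set X := eta * C; set Y := M * _ * _; lra.
apply/cvgrPdist_le => e e0.
have e20 : 0 < e / 4 by rewrite divr_gt0.
have [K K0 HK] := step _ e20.
have lim1 : K * (1 - r) @[r --> (1 : R)^'-] --> (0 : R).
  apply: cvg_at_left_filter; rewrite -[X in _ --> X](mulr0 K) -(subrr 1).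
  by apply: cvgMr; apply: cvgB; [exact: cvg_cst|exact: cvg_id].
have lim2 : L * (1 - poisson r pi) + al 0%N * poisson r pi @[r --> (1 : R)^'-] --> L.
  rewrite -[X in _ --> X](_ : L * (1 - 0) + al 0%N * 0 = L); last by ring.
  apply: cvgD; apply: cvgMr; last exact: poisson_pi_cvg.
  by apply: cvgB; [exact: cvg_cst|exact: poisson_pi_cvg].
move/cvgrPdist_le : lim1 => /(_ _ e20) lim1.
move/cvgrPdist_le : lim2 => /(_ _ e20) lim2.
near=> r.
have h1 : `|u r - (L * (1 - poisson r pi) + al 0%N * poisson r pi)| <= e / 4 + K * (1 - r).
  by near: r.
have h2 : `|0 - K * (1 - r)| <= e / 4 by near: r.
have h3 : `|L - (L * (1 - poisson r pi) + al 0%N * poisson r pi)| <= e / 4 by near: r.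
move: h2; rewrite sub0r normrN => /(le_trans (ler_norm _)) h2.
move: h1 h2 h3; set Z := _ + al 0%N * _; set Y := K * _ => h1 h2 h3.
rewrite -(subrKA Z); apply: (le_trans (ler_normD _ _)).
rewrite [X in _ + X <= _]distrC; lra.
Unshelve. all: by end_near. Qed.
End fatou.

Section fatou_real.
Context (R : realType).
Local Notation mu := (@lebesgue_measure R).
Implicit Types (al be : nat -> R) (k : nat).
Let I := @period2 R.

Lemma Rintegral_approx (u g : R -> R) (a b e : R) :
  continuous u -> mu.-integrable I (EFin \o g) -> - pi <= a -> b <= 3 * pi ->
  (\int[mu]_(x in I) `|(u x - g x)%:E| <= e%:E)%E ->
  `|\int[mu]_(x in `[a, b]) u x - \int[mu]_(x in `[a, b]) g x| <= e.
Proof.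
move=> cu ig ha hb he.
have mI : measurable (I : set (measurableTypeR R)) by exact: measurable_itv.
have sub : `[a, b] `<=` I.
  move=> x; rewrite /= !in_itv /= => /andP[ax xb].
  by apply/andP; split; [exact: le_trans ha ax|exact: le_trans xb hb].
have iab : mu.-integrable `[a, b] (EFin \o g) by exact: integrableS ig.
have iu : mu.-integrable `[a, b] (EFin \o u) by exact: continuous_itv_integrable.
have iuI : mu.-integrable I (EFin \o u) by exact: continuous_itv_integrable.
have iugI : mu.-integrable I (EFin \o (fun x => u x - g x)).
  by have := integrableB mI iuI ig; apply: eq_integrable.
rewrite -RintegralB // -lee_fin; apply: le_trans he.
rewrite EFin_normr_Rintegral //; last exact: integrableS iugI.
apply: (le_trans (le_abse_integral _ _ _)) => //.
  by have := integrableS mI (measurable_itv _) sub iugI => /(measurable_int mu).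
apply: ge0_subset_integral => //.
by apply: measurableT_comp => //; exact: (measurable_int mu iugI).
Qed.

(** Square-summability gives an L1 limit [g]; at almost every point its primitive has
derivative [g], and there the Abel means converge. *)
Theorem trig_fatou al be (u : R -> R -> R) :
  cvgn (series (fun k => al k ^+ 2 + be k ^+ 2)) ->
  (forall t r, 0 < r < 1 -> abel_sum al be t r @ \oo --> u t r) ->
  exists g : R -> R, [/\ mu.-integrable `[0, 2 * pi] (EFin \o g),
    \int[mu]_(x in `[0, 2 * pi]) g x = 2 * pi * al 0%N &
    {ae mu, forall t, 0 < t < 2 * pi -> u t r @[r --> (1 : R)^'-] --> g t}].
Proof.
move=> hc hu; have [g [ig Hg]] := trigsum_L1_cvg hc.
have p0 := pi_gt0 R.
have mI : measurable (I : set (measurableTypeR R)) by exact: measurable_itv.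
exists g; split.
- apply: integrableS ig => // x; rewrite /I /period2 /= !in_itv /= => /andP[x0 x2].
  by apply/andP; split; lra.
- apply/eqP; rewrite -subr_eq0 -normr_le0; apply/ler_addgt0Pr => e e0; rewrite add0r.
  have [N HN] := Hg _ e0.
  have := @Rintegral_approx (trigsum al be N.+1) g 0 (2 * pi) e
    (@continuous_trigsum _ al be _) ig _ _ (HN _ (leqnSn N)).
  have := @sym_primE R al be pi N.+1 pi p0.
  rewrite subrr (_ : pi + pi = 2 * pi); last by ring.
  move=> ->; rewrite distrC.
  have -> : 2 * sym_prim al be pi N.+1 pi = 2 * pi * al 0%N.
    rewrite /sym_prim big_nat_recl // big1 ?addr0; last first.
      by move=> k _; rewrite prim_cos_pi mulr0.
    by rewrite /trig prim_cos_pi mul0r cos0 sin0; ring.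
  by apply; lra.
(* cutting off makes [g] integrable on the whole line, as [FTC1Ny] needs *)
pose g0 := g \_ I.
have n2 : `|2^-1| = 2^-1 :> R by rewrite gtr0_norm // invr_gt0.
have ig0 : mu.-integrable setT (EFin \o g0).
  by rewrite /g0 -restrict_EFin; apply/integrable_restrict => //; rewrite setTI.
have lg0 : locally_integrable setT g0 by exact: integrable_locally_restrict.
have igS A : measurable A -> mu.-integrable A (EFin \o g0).
  by move=> mA; exact: integrableS ig0.
have := FTC1Ny (fun y => igS _ (measurable_itv _)) lg0.
set F := fun x => _; rewrite -/F => HF.
move: HF; apply: filterS; first exact: (ae_filter_ringOfSetsType mu).
move=> t [dF F't] /andP[t0 t2].
have g0E : g0 t = g t.
  by rewrite /g0 patchE mem_set // /I /period2 /= in_itv /=; apply/andP; split; lra.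
rewrite g0E in F't.
pose G h := (F (t + h) - F (t - h)) / 2.
pose C := fine (\int[mu]_x `|(g0 x)%:E|).
have FC x : `|F x| <= C.
  have [mg0 fing0] := integrableP _ _ _ ig0.
  rewrite -lee_fin fineK ?ge0_fin_numE //; last by apply: integral_ge0 => *; exact: abse_ge0.
  rewrite EFin_normr_Rintegral //; last exact: igS.
  apply: (le_trans (le_abse_integral _ _ _)) => //.
    exact: (measurable_int mu (igS _ _)).
  by apply: ge0_subset_integral => //; exact: measurableT_comp.
have FE h : 0 < h -> F (t + h) - F (t - h) = \int[mu]_(x in `[t - h, t + h]) g0 x.
  move=> h0; rewrite /F Rintegral_itvB ?Rintegral_itv_obnd_cbnd //; try exact: igS.
  by rewrite bnd_simp; lra.
apply: (@abel_sum_cvg R al be t (g t) (C + `|g t| * pi) G (u t)).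
- by apply: addr_ge0; [exact: le_trans (normr_ge0 _) (FC 0)|rewrite mulr_ge0 // ltW].
- exact: hu.
- move=> eta eta0; have [N HN] := Hg _ eta0.
  exists N => n Nn h /andP[]; rewrite le_eqVlt => /predU1P[<- _|h0 hpi].
    rewrite /G addr0 subr0 subrr mul0r subr0 /sym_prim big1 ?normr0 ?ltW // => k _.
    by rewrite prim_cos0 mulr0.
  have := @Rintegral_approx (trigsum al be n) g (t - h) (t + h) eta
    (@continuous_trigsum _ al be _) ig _ _ (HN _ Nn).
  rewrite sym_primE // /G FE //.
  have -> : \int[mu]_(x in `[t - h, t + h]) g0 x = \int[mu]_(x in `[t - h, t + h]) g x.
    apply: eq_Rintegral => x; rewrite inE /= in_itv /= => /andP[x1 x2].
    by rewrite /g0 patchE mem_set // /I /period2 /= in_itv /=; apply/andP; split; lra.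
  set A := \int[mu]_(x in _) _; set S := sym_prim _ _ _ _ _ => H.
  have : `|2 * S - A| <= eta by apply: H; lra.
  have -> : S - A / 2 = (2 * S - A) / 2 by field.
  rewrite normrM n2 => H1.
  by rewrite ler_pdivrMr //; apply: (le_trans H1); lra.
- move=> h /andP[h0 hpi]; apply: (le_trans (ler_normB _ _)); apply: lerD.
    rewrite /G normrM n2 ler_pdivrMr //.
    apply: (le_trans (ler_normB _ _)); rewrite mulr_natr mulr2n lerD //.
  by rewrite normrM (ger0_norm h0) ler_wpM2l.
- move=> eps eps0.
  have : h^-1 *: ((F \o shift t) (h *: 1) - F t) @[h --> 0^'] --> g t.
    by rewrite -F't derive1E; exact: dF.
  move=> /cvgrPdist_le /(_ _ eps0) [d /= d0 Hd].
  exists (d / 2); first by rewrite divr_gt0.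
  have Hd' (h : R) : `|h| < d -> h != 0 -> `|F (t + h) - F t - g t * h| <= eps * `|h|.
    move=> hd h0; have := Hd h; rewrite /= sub0r normrN => /(_ hd h0).
    rewrite /GRing.scale /= mulr1 [h + t]addrC => H.
    have -> : F (t + h) - F t - g t * h = - ((g t - h^-1 * (F (t + h) - F t)) * h).
      by field.
    by rewrite normrN normrM ler_wpM2r.
  move=> h /andP[]; rewrite le_eqVlt => /predU1P[<- _ _|h0 hpi hd].
    by rewrite /G addr0 subr0 subrr mul0r !mulr0 subr0 normr0.
  have hd' : `|h| < d by rewrite gtr0_norm //; lra.
  have := Hd' h hd'; rewrite gt_eqF // => /(_ isT) H1.
  have := Hd' (- h); rewrite normrN oppr_eq0 gt_eqF // => /(_ hd' isT) H2.
  rewrite (gtr0_norm h0) in H1 H2.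
  have -> : G h - g t * h = ((F (t + h) - F t - g t * h) - (F (t - h) - F t - g t * - h)) / 2.
    by rewrite /G; field.
  rewrite normrM n2 ler_pdivrMr //; apply: (le_trans (ler_normB _ _)).
  by rewrite mulr_natr mulr2n lerD.
Qed.
End fatou_real.

(** * Moduli and limits in R[i] *)

Section complex_basics.
Context (R : realType).
Local Notation nc := (@ComplexField.Normc.normc R).

Lemma normE (z : R[i]) : `|z| = (nc z)%:C%C.
Proof. by []. Qed.

Lemma in_discE (z : R[i]) : in_disc z <-> nc z < 1.
Proof. by rewrite /in_disc normE ltcR. Qed.

Lemma nc_ge0 (z : R[i]) : 0 <= nc z. Proof. by case: z => a b; exact: sqrtr_ge0. Qed.

Lemma ncM (x y : R[i]) : nc (x * y) = nc x * nc y.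
Proof. exact: ComplexField.Normc.normcM. Qed.

Lemma ncD (x y : R[i]) : nc (x + y) <= nc x + nc y.
Proof. exact: le_normcD. Qed.

Lemma ncN (x : R[i]) : nc (- x) = nc x.
Proof. exact: normcN. Qed.

Lemma nc_eq0 (x : R[i]) : (nc x == 0) = (x == 0).
Proof.
by apply/eqP/eqP => [/ComplexField.Normc.eq0_normc//|->]; rewrite ComplexField.Normc.normc0.
Qed.

Lemma nc0 : nc 0 = 0. Proof. exact: ComplexField.Normc.normc0. Qed.
Lemma nc1 : nc 1 = 1. Proof. exact: ComplexField.Normc.normc1. Qed.

Lemma nc_gt0 (x : R[i]) : (0 < nc x) = (x != 0).
Proof. by rewrite lt_def nc_eq0 nc_ge0 andbT. Qed.

Lemma ncX (x : R[i]) n : nc (x ^+ n) = nc x ^+ n.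
Proof. by elim: n => [|n IH]; rewrite ?expr0 ?nc1 // !exprS ncM IH. Qed.

Lemma nc_conj (x : R[i]) : nc (x^*%C) = nc x.
Proof. by case: x => a b; rewrite /= sqrrN. Qed.

Lemma nc_real (x : R) : nc x%:C%C = `|x|.
Proof. by rewrite /= expr0n addr0 sqrtr_sqr. Qed.

Lemma nc_sqr (x : R[i]) : nc x ^+ 2 = complex.Re x ^+ 2 + complex.Im x ^+ 2.
Proof. by case: x => a b /=; rewrite sqr_sqrtr // addr_ge0 ?sqr_ge0. Qed.

Lemma nc_sqrC (x : R[i]) : (nc x ^+ 2)%:C%C = x * x^*%C.
Proof. by rewrite -sqr_normc normE rmorphXn. Qed.

Lemma nc_Re (x : R[i]) : `|complex.Re x| <= nc x.
Proof.
rewrite -(@ler_pXn2r _ 2) ?nnegrE ?nc_ge0 // real_normK ?num_real // nc_sqr.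
by rewrite lerDl sqr_ge0.
Qed.

Lemma nc_Im (x : R[i]) : `|complex.Im x| <= nc x.
Proof.
rewrite -(@ler_pXn2r _ 2) ?nnegrE ?nc_ge0 // real_normK ?num_real // nc_sqr.
by rewrite lerDr sqr_ge0.
Qed.

Lemma nc_ReIm (x : R[i]) : nc x <= `|complex.Re x| + `|complex.Im x|.
Proof.
rewrite -(@ler_pXn2r _ 2) ?nnegrE ?nc_ge0 ?addr_ge0 // nc_sqr sqrrD.
rewrite !real_normK ?num_real // lerD2r lerDl.
by rewrite mulrn_wge0 // mulr_ge0.
Qed.

(** Radii in [R[i]] are reduced to real ones. *)
Lemma cvgC_normcP (T : Type) (F : set_system T) (FF : Filter F) (f : T -> R[i]) (l : R[i]) :
  f @ F --> l <-> forall e : R, 0 < e -> \forall x \near F, nc (l - f x) <= e.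
Proof.
split=> [/cvgrPdist_le H e e0|H].
  have e0' : 0 < e%:C%C by rewrite ltcR.
  have := H _ e0'; apply: filterS => x.
  by rewrite normE lecR.
apply/cvgrPdist_le => e e0; have [e1 e2] : 0 < complex.Re e /\ e = (complex.Re e)%:C%C.
  by case: e e0 => a b; rewrite ltcE /= => /andP[/eqP -> ?]; split.
have := H _ e1; apply: filterS => x.
by rewrite e2 normE lecR.
Qed.

Lemma cvg_complex (T : Type) (F : set_system T) (FF : Filter F) (f : T -> R[i]) (a b : R) :
  complex.Re (f x) @[x --> F] --> a -> complex.Im (f x) @[x --> F] --> b ->
  f @ F --> (a +i* b)%C.
Proof.
move=> /cvgrPdist_le Ha /cvgrPdist_le Hb; apply/cvgC_normcP => e e0.
have e20 : 0 < e / 2 by rewrite divr_gt0.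
apply: filterS2 (Ha _ e20) (Hb _ e20) => x h1 h2.
apply: (le_trans (nc_ReIm _)); rewrite [leRHS]splitr.
by apply: lerD; [move: h1|move: h2]; case: (f x).
Qed.

Lemma cvg_Re (T : Type) (F : set_system T) (FF : Filter F) (f : T -> R[i]) (l : R[i]) :
  f @ F --> l -> complex.Re (f x) @[x --> F] --> complex.Re l.
Proof.
move=> /cvgC_normcP H; apply/cvgrPdist_le => e /H; apply: filterS => x.
by apply: le_trans; apply: le_trans (nc_Re _); case: (f x); case: (l).
Qed.

Lemma cvg_Im (T : Type) (F : set_system T) (FF : Filter F) (f : T -> R[i]) (l : R[i]) :
  f @ F --> l -> complex.Im (f x) @[x --> F] --> complex.Im l.
Proof.
move=> /cvgC_normcP H; apply/cvgrPdist_le => e /H; apply: filterS => x.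
by apply: le_trans; apply: le_trans (nc_Im _); case: (f x); case: (l).
Qed.

Lemma cvg_real_complex (T : Type) (F : set_system T) (FF : Filter F) (f : T -> R) (l : R) :
  f @ F --> l -> (f x)%:C%C @[x --> F] --> l%:C%C.
Proof. by move=> H; apply: cvg_complex => //=; exact: cvg_cst. Qed.

Lemma ReD (x y : R[i]) : complex.Re (x + y) = complex.Re x + complex.Re y.
Proof. by case: x; case: y. Qed.
Lemma ImD (x y : R[i]) : complex.Im (x + y) = complex.Im x + complex.Im y.
Proof. by case: x; case: y. Qed.

Lemma Re_series (u : nat -> R[i]) n :
  complex.Re (series u n) = series (fun k => complex.Re (u k)) n.
Proof.
by rewrite /series /=; elim/big_ind2 : _ => // x1 x2 y1 y2 <- <-; rewrite ReD.
Qed.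

Lemma Im_series (u : nat -> R[i]) n :
  complex.Im (series u n) = series (fun k => complex.Im (u k)) n.
Proof.
by rewrite /series /=; elim/big_ind2 : _ => // x1 x2 y1 y2 <- <-; rewrite ImD.
Qed.

Lemma cvg_series_complex (u : nat -> R[i]) (M rho : R) : 0 <= rho -> rho < 1 ->
  (forall k, nc (u k) <= M * rho ^+ k) -> cvgn (series u).
Proof.
move=> rho0 rho1 uM.
have geo : cvgn (series (geometric M rho)).
  by apply: is_cvg_geometric_series; rewrite ger0_norm.
have real_part (v : nat -> R) : (forall k, `|v k| <= nc (u k)) -> cvgn (series v).
  move=> vu; apply: normed_cvg; apply: series_le_cvg geo => k //.
    exact: normr_ge0.
    exact: le_trans (nc_ge0 (u k)) (uM k).
  exact: le_trans (vu k) (uM k).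
have h1 := real_part _ (fun k => nc_Re (u k)).
have h2 := real_part _ (fun k => nc_Im (u k)).
apply/cvg_ex; exists (limn (series (fun k => complex.Re (u k))) +i*
  limn (series (fun k => complex.Im (u k))))%C.
apply: cvg_complex.
  by under eq_fun do rewrite Re_series.
by under eq_fun do rewrite Im_series.
Qed.

End complex_basics.

(** * Algebra of the Hardy space *)

Section hardy.
Context (R : realType).
Local Notation nc := (@ComplexField.Normc.normc R).
Local Notation cj x := (x^*%C).
Implicit Types (c d : nat -> R[i]) (f g : R[i] -> R[i]) (a z : R[i]).

Definition sqsum c := cvgn (series (fun k => nc (c k) ^+ 2)).

Definition represents c f :=
  forall z, in_disc z -> series (fun k => c k * z ^+ k) @ \oo --> f z.

Lemma cvg_succ (u : nat -> R[i]) (l : R[i]) :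
  (fun n => u n.+1) @ \oo --> l <-> u @ \oo --> l.
Proof. by rewrite -(cvg_shiftS u). Qed.

Lemma sqsumP c : sqsum c <-> exists B, forall n, \sum_(0 <= k < n) nc (c k) ^+ 2 <= B.
Proof.
have nd : nondecreasing_seq (series (fun k => nc (c k) ^+ 2)).
  by apply/nondecreasing_series => k _ _; exact: sqr_ge0.
split=> [hc|[B hB]].
  exists (limn (series (fun k => nc (c k) ^+ 2))) => n.
  exact: nondecreasing_cvgn_le.
apply: nondecreasing_is_cvgn => //; exists B => _ [n _ <-]; exact: hB.
Qed.

Lemma sqsum_bounded c : sqsum c -> exists2 M, 0 <= M & forall k, nc (c k) <= M.
Proof.
move=> /sqsumP[B hB]; have B0 : 0 <= B by have := hB 0%N; rewrite big_geq.
exists (B + 1) => [|k]; first by rewrite addr_ge0.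
rewrite -(@ler_pXn2r _ 2) ?nnegrE ?nc_ge0 ?addr_ge0 //.
have := hB k.+1; rewrite big_nat_recr //= => h.
have : nc (c k) ^+ 2 <= B.
  by apply: le_trans h; rewrite lerDr sumr_ge0 // => i _; exact: sqr_ge0.
by move/le_trans; apply; nra.
Qed.

Lemma sqsum_cvg c z : sqsum c -> in_disc z ->
  cvgn (series (fun k => c k * z ^+ k)).
Proof.
move=> /sqsum_bounded[M M0 hM] /in_discE z1.
apply: (@cvg_series_complex R _ M (nc z)) => //; first exact: nc_ge0.
by move=> k; rewrite ncM ncX ler_wpM2r ?exprn_ge0 ?nc_ge0.
Qed.

Lemma cvg_bounded_pow d z (M : R) : (forall k, nc (d k) <= M) -> in_disc z ->
  d n * z ^+ n @[n --> \oo] --> (0 : R[i]).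
Proof.
move=> dM /in_discE z1.
have M0 : 0 <= M := le_trans (nc_ge0 _) (dM 0%N).
have H : (fun n => M * nc z ^+ n) @ \oo --> (0 : R).
  rewrite -[X in _ --> X](mulr0 M); apply: cvgMr.
  by apply: cvg_expr; rewrite ger0_norm ?nc_ge0.
apply/cvgC_normcP => e e0.
move/cvgrPdist_le : H => /(_ _ e0); apply: filterS => n.
rewrite !sub0r normrN ncN ncM ncX ger0_norm; last by rewrite mulr_ge0 ?exprn_ge0 ?nc_ge0.
by apply: le_trans; rewrite ler_wpM2r ?exprn_ge0 ?nc_ge0.
Qed.

Lemma hardy2P f : hardy2 f <-> exists2 c, sqsum c & represents c f.
Proof. by split=> [[c [sc cf]]|[c sc cf]]; exists c. Qed.

Lemma hardy2_ext f g : (forall z, in_disc z -> f z = g z) -> hardy2 f -> hardy2 g.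
Proof.
move=> fg /hardy2P[c sc cf]; apply/hardy2P; exists c; first exact: sc.
by move=> z z1; rewrite -(fg z z1); exact: cf.
Qed.

Lemma hardy2_cst (k : R[i]) : hardy2 (fun _ => k).
Proof.
apply/hardy2P; exists (fun n => if n is 0%N then k else 0).
  apply/sqsumP.
  exists (nc k ^+ 2) => n; elim: n => [|n IH]; first by rewrite big_geq // sqr_ge0.
  rewrite big_nat_recl // big1 ?addr0 // => i _.
  by rewrite nc0 expr0n.
move=> z z1; apply/cvgC_normcP => e e0; exists 1%N => // n /= n0.
rewrite /series /= -(prednK n0) big_nat_recl // big1 => [|i _]; last by rewrite mul0r.
by rewrite expr0 mulr1 addr0 subrr nc0 ltW.
Qed.

Lemma sqsumD c d : sqsum c -> sqsum d -> sqsum (fun k => c k + d k).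
Proof.
move=> /sqsumP[B hB] /sqsumP[D hD]; apply/sqsumP; exists (2 * B + 2 * D) => n.
apply: (@le_trans _ _ (2 * \sum_(0 <= k < n) nc (c k) ^+ 2 + 2 * \sum_(0 <= k < n) nc (d k) ^+ 2)).
  rewrite !mulr_sumr -big_split /=; apply: ler_sum => k _.
  have h := ncD (c k) (d k).
  apply: (@le_trans _ _ ((nc (c k) + nc (d k)) ^+ 2)).
    by rewrite lerXn2r ?nnegrE ?addr_ge0 ?nc_ge0.
  by rewrite -subr_ge0 (_ : _ - _ = (nc (c k) - nc (d k)) ^+ 2) ?sqr_ge0 //; ring.
by apply: lerD; rewrite ler_wpM2l.
Qed.

Lemma hardy2D f g : hardy2 f -> hardy2 g -> hardy2 (fun z => f z + g z).
Proof.
move=> /hardy2P[c sc cf] /hardy2P[d sd dg]; apply/hardy2P.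
exists (fun k => c k + d k); first exact: sqsumD.
move=> z z1.
rewrite [X in X @ _ --> _](_ : _ = series (fun k => c k * z ^+ k) +
  series (fun k => d k * z ^+ k)); last first.
  apply/funext => n; rewrite fctE /series /= -big_split /=.
  by apply: eq_bigr => i _; rewrite mulrDl.
by apply: cvgD; [exact: cf|exact: dg].
Qed.

Lemma hardy2Z (k : R[i]) f : hardy2 f -> hardy2 (fun z => k * f z).
Proof.
move=> /hardy2P[c sc cf]; apply/hardy2P; exists (fun j => k * c j).
  move/sqsumP : sc => [B hB]; apply/sqsumP; exists (nc k ^+ 2 * B) => n.
  under eq_bigr do rewrite ncM exprMn.
  by rewrite -mulr_sumr ler_wpM2l ?sqr_ge0.
move=> z z1.
rewrite [X in X @ _ --> _](_ : _ = (fun n => k * series (fun j => c j * z ^+ j) n)); last first.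
  apply/funext => n; rewrite /series /= mulr_sumr.
  by apply: eq_bigr => i _; rewrite mulrA.
by apply: cvgMr; exact: cf.
Qed.

Lemma hardy2B f g : hardy2 f -> hardy2 g -> hardy2 (fun z => f z - g z).
Proof.
move=> hf hg; apply: (hardy2_ext (f := fun z => f z + (-1) * g z)).
  by move=> z _; rewrite mulN1r.
apply: hardy2D.
  exact: hf.
exact: hardy2Z.
Qed.

Lemma hardy2_mulX f : hardy2 f -> hardy2 (fun z => z * f z).
Proof.
move=> /hardy2P[c sc cf]; apply/hardy2P; exists (fun j => if j is i.+1 then c i else 0).
  move/sqsumP : sc => [B hB].
  apply/sqsumP; exists B => -[|n].
    by rewrite big_geq //; have := hB 0%N; rewrite big_geq.
  by rewrite big_nat_recl // nc0 expr0n add0r.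
move=> z z1; apply/cvg_succ.
rewrite [X in X @ _ --> _](_ : _ = (fun n => z * series (fun j => c j * z ^+ j) n)); last first.
  apply/funext => n; rewrite /series /= big_nat_recl // mul0r add0r mulr_sumr.
  by apply: eq_bigr => i _; rewrite exprS mulrCA.
by apply: cvgMr; exact: cf.
Qed.

(** Convexity of the square, for the weights [1 - A] and [A]. *)
Lemma sqr_convex_le (A x y : R) : 0 <= A -> A < 1 ->
  (y + A * x) ^+ 2 <= y ^+ 2 / (1 - A) + A * x ^+ 2.
Proof.
move=> A0 A1; have B0 : 0 < 1 - A by rewrite subr_gt0.
rewrite -subr_ge0.
have -> : y ^+ 2 / (1 - A) + A * x ^+ 2 - (y + A * x) ^+ 2 =
    A / (1 - A) * (y - (1 - A) * x) ^+ 2.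
  by field; rewrite gt_eqF // subr_gt0.
by rewrite mulr_ge0 ?sqr_ge0 // divr_ge0 // ltW.
Qed.

(** Coefficients of the product of a power series with [1 / (1 - b z)]. *)
Fixpoint geom_conv (b : R[i]) c n : R[i] :=
  if n is m.+1 then c m.+1 + b * geom_conv b c m else c 0%N.

(** By [sqr_convex_le] the squared moduli satisfy [d_(n+1)^2 <= y_n + A * d_n^2] with
[A < 1] and [y] summable, so their partial sums stay bounded. *)
Lemma sqsum_geom_conv b c : nc b < 1 -> sqsum c -> sqsum (geom_conv b c).
Proof.
move=> b1 /sqsumP[B hB]; set A := nc b in b1.
have A0 : 0 <= A := nc_ge0 b.
have A1 : 0 < 1 - A by rewrite subr_gt0.
set d := geom_conv b c.
apply/sqsumP; exists ((nc (c 0%N) ^+ 2 + B / (1 - A)) / (1 - A)) => n.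
set K := nc _ ^+ 2 + _.
have K0 : 0 <= K.
  apply: addr_ge0; first exact: sqr_ge0.
  apply: divr_ge0; last exact: ltW.
  by have := hB 0%N; rewrite big_geq.
elim: n => [|n IH]; first by rewrite big_geq // divr_ge0 // ltW.
rewrite big_nat_recl //.
apply: (@le_trans _ _ (K + A * (K / (1 - A)))); last first.
  have -> : K + A * (K / (1 - A)) = K / (1 - A) by field; rewrite gt_eqF // subr_gt0.
  exact: lexx.
rewrite /K -addrA lerD2l.
apply: (@le_trans _ _ (\sum_(0 <= k < n) (nc (c k.+1) ^+ 2 / (1 - A) + A * nc (d k) ^+ 2))).
  apply: ler_sum => k _; apply: le_trans (sqr_convex_le _ _ A0 b1).
  rewrite lerXn2r ?nnegrE ?addr_ge0 ?mulr_ge0 ?nc_ge0 // {1}/d /= -/d.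
  by rewrite /A -ncM ncD.
rewrite big_split /= -mulr_suml -mulr_sumr; apply: lerD; last by rewrite ler_wpM2l.
rewrite ler_wpM2r ?invr_ge0 ?(ltW A1) //.
apply: le_trans (hB n.+1); rewrite big_nat_recl // lerDr sqr_ge0 //.
Qed.

Lemma disc_mul_neq1 a z : in_disc a -> in_disc z -> 1 - cj a * z != 0.
Proof.
move=> /in_discE a1 /in_discE z1; rewrite subr_eq0; apply/eqP => h.
have : nc (cj a * z) < 1.
  rewrite ncM nc_conj; apply: le_lt_trans z1.
  by rewrite -[leRHS]mul1r ler_wpM2r ?nc_ge0 // ltW.
by rewrite -h nc1 ltxx.
Qed.

(** The coefficients [d] of the quotient are determined by [d_(n+1) = c_(n+1) +
conj(a) d_n]; multiplying out, the partial sums differ from those of [f] by one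
term that tends to 0. *)
Lemma hardy2_div f a : in_disc a -> hardy2 f -> hardy2 (fun z => f z / (1 - cj a * z)).
Proof.
move=> a1 /hardy2P[c sc cf]; apply/hardy2P.
have b1 : nc (cj a) < 1 by rewrite nc_conj; apply/in_discE.
have sd := sqsum_geom_conv b1 sc.
exists (geom_conv (cj a) c); first exact: sd.
move=> z z1.
set b := cj a; set d := geom_conv b c.
have dz0 := disc_mul_neq1 a1 z1; rewrite -/b in dz0.
have E n : series (fun k => d k * z ^+ k) n.+1 =
    (series (fun k => c k * z ^+ k) n.+1 - b * z * (d n * z ^+ n)) / (1 - b * z).
  apply: (canRL (mulfK dz0)).
  elim: n => [|n IH].
    by rewrite /series /= !big_nat1 expr0 /d /=; ring.
  rewrite /series /= big_nat_recr //= [in RHS]big_nat_recr //= mulrDl.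
  move: IH; rewrite /series /= => ->.
  by have -> : d n.+1 = c n.+1 + b * d n by []; rewrite !exprS; ring.
apply/cvg_succ.
rewrite [X in X @ _ --> _](_ : _ = (fun n => (series (fun k => c k * z ^+ k) n.+1 -
   b * z * (d n * z ^+ n)) / (1 - b * z))); last first.
  by apply/funext => n; rewrite E.
apply: cvgMl; rewrite -[X in _ --> X]subr0; apply: cvgB.
  exact/cvg_succ/cf.
rewrite -[X in _ --> X](mulr0 (b * z)); apply: cvgMr.
have [M M0 dM] := sqsum_bounded sd.
exact: cvg_bounded_pow dM z1.
Qed.

End hardy.

(** * Division by z - a, continuity and derivatives *)

Section hardy_local.
Context (R : realType).
Local Notation nc := (@ComplexField.Normc.normc R).
Local Notation cj x := (x^*%C).
Implicit Types (c d : nat -> R[i]) (f g : R[i] -> R[i]) (a z : R[i]).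

Lemma nc_dist (x y : R[i]) : `|nc x - nc y| <= nc (x - y).
Proof.
have h1 : nc x <= nc (x - y) + nc y by rewrite -{1}(subrK y x) ncD.
have h2 : nc y <= nc (x - y) + nc x.
  by rewrite -(ncN (x - y)) opprB -{1}(subrK x y) ncD.
by rewrite ler_norml; apply/andP; split; lra.
Qed.

Lemma cvg_nc_le (u : nat -> R[i]) (l : R[i]) (B : R) :
  u @ \oo --> l -> (forall n, nc (u n) <= B) -> nc l <= B.
Proof.
move=> /cvgC_normcP H uB; apply/ler_addgt0Pr => e e0.
have [n hn] := filter_ex (H _ e0).
by rewrite -(subrK (u n) l) addrC; apply: (le_trans (ncD _ _)); apply: lerD.
Qed.

Lemma cvgC_unique (u : nat -> R[i]) (l l' : R[i]) :
  u @ \oo --> l -> u @ \oo --> l' -> l = l'.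
Proof. by move=> h h'; apply: (cvg_unique _ h h'); exact: norm_hausdorff. Qed.

Lemma nc_sum_pow_le c z (M : R) n : nc z < 1 -> (forall k, nc (c k) <= M) ->
  nc (series (fun k => c k * z ^+ k) n) <= M / (1 - nc z).
Proof.
move=> z1 cM; have z0 := nc_ge0 z; set A := nc z in z0 z1 *.
have A1 : 0 < 1 - A by rewrite subr_gt0.
have M0 : 0 <= M := le_trans (nc_ge0 _) (cM 0%N).
elim: n c cM => [|n IH] c cM.
  by rewrite /series /= big_geq // nc0 divr_ge0 // ltW.
rewrite /series /= big_nat_recl // expr0 mulr1.
have -> : \sum_(0 <= i < n) c i.+1 * z ^+ i.+1 = z * series (fun k => c k.+1 * z ^+ k) n.
  by rewrite /series /= mulr_sumr; apply: eq_bigr => i _; rewrite exprS mulrCA.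
apply: (le_trans (ncD _ _)); rewrite ncM.
have h := IH (fun k => c k.+1) (fun k => cM k.+1).
apply: (@le_trans _ _ (M + A * (M / (1 - A)))).
  by apply: lerD => //; rewrite ler_wpM2l.
have -> : M + A * (M / (1 - A)) = M / (1 - A) by field; rewrite gt_eqF // subr_gt0.
exact: lexx.
Qed.

Lemma hardy2_bounded_on f (rho : R) : hardy2 f -> rho < 1 ->
  exists2 K, 0 < K & forall z, nc z <= rho -> nc (f z) <= K.
Proof.
move=> [c [sc cf]] rho1; have [M M0 cM] := sqsum_bounded sc.
have r1 : 0 < 1 - rho by rewrite subr_gt0.
exists (M / (1 - rho) + 1) => [|z zr]; first by rewrite ltr_wpDl // divr_ge0 // ltW.
have z1 : nc z < 1 := le_lt_trans zr rho1.
apply: (@le_trans _ _ (M / (1 - rho))); last by rewrite lerDl.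
apply: (cvg_nc_le (cf z ((in_discE z).2 z1))) => n.
apply: (le_trans (nc_sum_pow_le _ z1 cM)).
by rewrite ler_wpM2l // lef_pV2 ?posrE ?subr_gt0 //; lra.
Qed.

(** The coefficients of the quotient are the tails [d_k = sum_j c_(k+1+j) a^j]. They
satisfy [d_k = c_(k+1) + a d_(k+1)], which gives square-summability as in
[sqsum_geom_conv], now with the recurrence read backwards. *)
Lemma hardy2_factor f a : hardy2 f -> in_disc a ->
  exists2 g, hardy2 g & forall z, in_disc z -> f z = f a + (z - a) * g z.
Proof.
move=> /hardy2P[c sc cf] ad; have /in_discE a1 := ad.
have a0 := nc_ge0 a; set A := nc a in a0 a1.
have A1 : 0 < 1 - A by rewrite subr_gt0.
have [M M0 cM] := sqsum_bounded sc.
pose t k := series (fun j => c (k + j)%N * a ^+ j).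
have ct k : cvgn (t k).
  apply: (@cvg_series_complex R _ M A) => // j.
  by rewrite ncM ncX ler_wpM2r ?exprn_ge0.
pose d k := limn (t k.+1).
have td k : t k.+1 @ \oo --> d k by exact: ct.
(* peel off the first term of the tail *)
have tE k n : t k n.+1 = c k + a * t k.+1 n.
  rewrite /t /series /= big_nat_recl // addn0 expr0 mulr1; congr (_ + _).
  rewrite mulr_sumr; apply: eq_bigr => i _.
  by rewrite exprS addnS addSn mulrCA.
have t_lim k : t k @ \oo --> c k + a * d k.
  apply/cvg_succ; rewrite (_ : (fun n => _) = (fun n => c k + a * t k.+1 n)); last first.
    by apply/funext => n; rewrite tE.
  by apply: cvgD; [exact: cvg_cst|apply: cvgMr; exact: td].
have d_rec k : d k = c k.+1 + a * d k.+1 by apply: cvgC_unique (td k) (t_lim _).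
have fa : f a = c 0%N + a * d 0%N.
  apply: cvgC_unique (cf a ad) _; exact: (t_lim 0%N).
have dm k : nc (d k) <= M / (1 - A).
  apply: (cvg_nc_le (td k)) => n.
  exact: (@nc_sum_pow_le (fun j => c (k.+1 + j)%N)).
set m := M / (1 - A) in dm.
have m0 : 0 <= m by rewrite divr_ge0 // ltW.
have sd : sqsum d.
  move/sqsumP : sc => [B hB].
  apply/sqsumP; exists ((B / (1 - A) + A * m ^+ 2) / (1 - A)) => n.
  rewrite ler_pdivlMr // mulrBr mulr1 lerBlDr -addrA [_ * A]mulrC -mulrDr.
  apply: (@le_trans _ _ (\sum_(0 <= k < n) (nc (c k.+1) ^+ 2 / (1 - A) + A * nc (d k.+1) ^+ 2))).
    apply: ler_sum => k _; apply: le_trans (sqr_convex_le _ _ a0 a1).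
    rewrite lerXn2r ?nnegrE ?addr_ge0 ?mulr_ge0 ?nc_ge0 // {1}d_rec.
    by rewrite /A -ncM ncD.
  rewrite big_split /= -mulr_suml -mulr_sumr; apply: lerD.
    rewrite ler_wpM2r ?invr_ge0 ?(ltW A1) //.
    by apply: le_trans (hB n.+1); rewrite big_nat_recl // lerDr sqr_ge0.
  rewrite ler_wpM2l //.
  apply: (@le_trans _ _ (\sum_(0 <= k < n.+1) nc (d k) ^+ 2)).
    by rewrite [leRHS]big_nat_recl // lerDr sqr_ge0.
  rewrite big_nat_recr //= addrC lerD2r lerXn2r ?nnegrE ?nc_ge0 //.
exists (fun z => limn (series (fun k => d k * z ^+ k))).
  by apply/hardy2P; exists d; [exact: sd|move=> z z1; exact: sqsum_cvg].
move=> z z1; have Hd := sqsum_cvg sd z1.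
apply/eqP; rewrite addrC -subr_eq; apply/eqP.
have E n : (z - a) * series (fun k => d k * z ^+ k) n.+1 =
    z * (d n * z ^+ n) + series (fun k => c k * z ^+ k) n.+1 - f a.
  elim: n => [|n IH].
    by rewrite /series /= !big_nat1 expr0 fa; ring.
  rewrite /series /= big_nat_recr //= [in RHS]big_nat_recr //= mulrDr.
  by move: IH; rewrite /series /= => ->; rewrite {1}d_rec !exprS; ring.
have L1 : (fun n => (z - a) * series (fun k => d k * z ^+ k) n.+1) @ \oo -->
    (z - a) * limn (series (fun k => d k * z ^+ k)).
  apply: cvgMr; exact/cvg_succ/Hd.
apply: (cvgC_unique _ L1).
under eq_fun do rewrite E.
have -> : f z - f a = z * 0 + f z - f a by rewrite mulr0 add0r.
apply: cvgB; last exact: cvg_cst.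
apply: cvgD; first by apply: cvgMr; exact: cvg_bounded_pow dm z1.
exact/cvg_succ/cf.
Qed.

Lemma near_nc a (e : R) : 0 < e -> \forall z \near a, nc (a - z) <= e.
Proof. by move=> e0; have /cvgC_normcP := @cvg_id _ (nbhs a); apply. Qed.

Lemma near_in_disc a : in_disc a -> \forall z \near a, in_disc z.
Proof.
move=> /in_discE a1; have e0 : 0 < (1 - nc a) / 2 by rewrite divr_gt0 // subr_gt0.
apply: filterS (near_nc a e0) => z h; apply/in_discE.
have := nc_dist z a; rewrite -(ncN (z - a)) opprB => /ler_normlP[_]; lra.
Qed.

(** The quotient of [hardy2_factor] is bounded near [a]. *)
Lemma hardy2_continuous f a : hardy2 f -> in_disc a -> f z @[z --> a] --> f a.
Proof.
move=> hf ad; have [g hg fg] := hardy2_factor hf ad.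
have /in_discE a1 := ad.
(* a radius strictly between [nc a] and 1 *)
pose rho := (1 + nc a) / 2.
have rho1 : rho < 1 by rewrite /rho; lra.
have [K K0 gK] := hardy2_bounded_on hg rho1.
apply/(cvgC_normcP (nbhs_filter a)) => e e0.
have r0 : 0 < (1 - nc a) / 2 by rewrite divr_gt0 // subr_gt0.
have eK : 0 < e / K by rewrite divr_gt0.
near=> z.
have h1 : nc (a - z) <= (1 - nc a) / 2 by near: z; exact: near_nc.
have h2 : nc (a - z) <= e / K by near: z; exact: near_nc.
have zr : nc z <= rho.
  have := nc_dist z a; rewrite -(ncN (z - a)) opprB => /ler_normlP[_].
  by rewrite /rho; lra.
have zd : in_disc z by apply/in_discE; exact: le_lt_trans rho1.
rewrite (fg z zd) opprD addrA subrr add0r ncN ncM -ncN opprB.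
have Kn0 : K != 0 by rewrite gt_eqF.
by rewrite -(divfK Kn0 e); apply: ler_pM; rewrite ?nc_ge0 ?gK.
Unshelve. all: by end_near. Qed.

(** The difference quotient of [f] at [a] is [g (a + h)], and [g] is continuous. *)
Lemma hardy2_is_derive f g a : hardy2 g -> in_disc a ->
  (forall z, in_disc z -> f z = f a + (z - a) * g z) -> is_derive a 1 f (g a).
Proof.
move=> hg ad fg.
have H : h^-1 *: ((f \o shift a) (h *: 1) - f a) @[h --> 0^'] --> g a.
  have E : \forall h \near (0 : R[i])^', g (h + a) = h^-1 *: ((f \o shift a) (h *: 1) - f a).
    have /in_discE a1 := ad.
    have r0 : 0 < (1 - nc a) / 2 by rewrite divr_gt0 // subr_gt0.
    have N : \forall h \near (0 : R[i])^', nc (0 - h) <= (1 - nc a) / 2.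
      exact: nbhs_dnbhs (near_nc 0 r0).
    have N0 : \forall h \near (0 : R[i])^', h != 0 by exact: nbhs_dnbhs_neq.
    apply: filterS2 N N0 => h hr h0.
    have hd : in_disc (h + a).
      by apply/in_discE; apply: (le_lt_trans (ncD _ _)); move: hr; rewrite sub0r ncN; lra.
    rewrite /= /GRing.scale /= mulr1 (fg _ hd) addrK.
    by rewrite [f a + _]addrC addrK mulKf.
  apply: cvg_trans (near_eq_cvg E) _.
  have : g (h + a) @[h --> (0 : R[i])] --> g a.
    have sh : h + a @[h --> (0 : R[i])] --> 0 + a.
      apply/(cvgC_normcP (nbhs_filter (0 : R[i]))) => e e0.
      by apply: filterS (near_nc 0 e0) => h; rewrite opprD addrACA subrr addr0.
    rewrite add0r in sh.
    have := cvg_comp _ _ sh (hardy2_continuous hg ad). exact.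
  by move=> H' P hP; apply: nbhs_dnbhs; exact: H'.
split; first by apply/cvg_ex; eexists; exact: H.
by apply/cvg_lim => //; exact: norm_hausdorff.
Qed.

End hardy_local.

(** * Radial limits of Hardy functions *)

Section boundary.
Context (R : realType).
Local Notation mu := (@lebesgue_measure R).
Local Notation nc := (@ComplexField.Normc.normc R).
Local Notation cj x := (x^*%C).
Implicit Types (f g h : R[i] -> R[i]) (a z l m : R[i]) (t : R).

(** Radial limits as a relation: they add and multiply, whereas [boundary] takes a
default value where there is no limit. *)
Definition radial f t l := f (r%:C%C * expi t) @[r --> (1 : R)^'-] --> l.

Lemma nc_expi t : nc (expi t) = 1.
Proof. by rewrite /expi /= cos2Dsin2 sqrtr1. Qed.

Lemma expi_conj t : expi t * cj (expi t) = 1.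
Proof. by rewrite -nc_sqrC nc_expi expr1n. Qed.

Lemma expi_neq0 t : expi t != 0.
Proof. by rewrite -nc_eq0 nc_expi oner_eq0. Qed.

Lemma expiX t k : expi t ^+ k = expi (k%:R * t).
Proof.
elim: k => [|k IH]; first by rewrite expr0 mul0r /expi cos0 sin0.
rewrite exprS IH -[k.+1%:R]natr1 mulrDl mul1r /expi cosD sinD; simpc.
by congr (_ +i* _)%C; ring.
Qed.

Lemma in_disc_radius (r t : R) : 0 < r < 1 -> in_disc (r%:C%C * expi t).
Proof.
by move=> /andP[r0 r1]; apply/in_discE; rewrite ncM nc_expi nc_real mulr1 gtr0_norm.
Qed.

Lemma near_radius : \forall r \near (1 : R)^'-, 0 < r < 1.
Proof.
near=> r; apply/andP; split; first by near: r; exact: nbhs_left_gt.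
by near: r; exact: nbhs_left_lt.
Unshelve. all: by end_near. Qed.

Lemma radial_ext f g t l : (forall z, in_disc z -> f z = g z) -> radial f t l -> radial g t l.
Proof.
move=> fg; apply: cvg_trans; apply: near_eq_cvg.
by apply: filterS near_radius => r hr; rewrite fg //; exact: in_disc_radius.
Qed.

Lemma radial_unique f t l m : radial f t l -> radial f t m -> l = m.
Proof. by move=> h h'; apply: (cvg_unique _ h h'); exact: norm_hausdorff. Qed.

Lemma boundaryE f t l : radial f t l -> boundary f t = l.
Proof. by move=> h; apply: (cvg_lim _ h); exact: norm_hausdorff. Qed.

Lemma radial_cst t l : radial (fun _ => l) t l.
Proof. exact: cvg_cst. Qed.

Lemma radial_id t : radial id t (expi t).
Proof.
rewrite /radial -[X in _ --> X]mul1r; apply: cvgM; last exact: cvg_cst.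
by apply: (@cvg_real_complex R _ (1 : R)^'-); apply: cvg_at_left_filter; exact: cvg_id.
Qed.

Lemma radialD f g t l m : radial f t l -> radial g t m -> radial (fun z => f z + g z) t (l + m).
Proof. exact: cvgD. Qed.

Lemma radialB f g t l m : radial f t l -> radial g t m -> radial (fun z => f z - g z) t (l - m).
Proof. exact: cvgB. Qed.

Lemma radialM f g t l m : radial f t l -> radial g t m -> radial (fun z => f z * g z) t (l * m).
Proof. exact: cvgM. Qed.

Lemma radialV f t l : l != 0 -> radial f t l -> radial (fun z => (f z)^-1) t l^-1.
Proof. by move=> l0 h; apply: cvgV. Qed.

Lemma expi_den_neq0 a t : in_disc a -> 1 - cj a * expi t != 0.
Proof.
move=> /in_discE a1; rewrite subr_eq0; apply/eqP => h.
have : nc (cj a * expi t) = nc a by rewrite ncM nc_expi mulr1 nc_conj.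
by rewrite -h nc1 => e; move: a1; rewrite -e ltxx.
Qed.

(** Along a radius, the real and imaginary parts of the power series are Abel sums of
two real trigonometric series with the same square-summable coefficients up to
exchange and sign. *)
Theorem hardy2_fatou f : hardy2 f -> exists F : R -> R[i],
  [/\ mu.-integrable `[0, 2 * pi] (EFin \o (fun t => complex.Re (F t))),
      mu.-integrable `[0, 2 * pi] (EFin \o (fun t => complex.Im (F t))),
      \int[mu]_(t in `[0, 2 * pi]) complex.Re (F t) = 2 * pi * complex.Re (f 0),
      \int[mu]_(t in `[0, 2 * pi]) complex.Im (F t) = 2 * pi * complex.Im (f 0) &
      {ae mu, forall t, 0 < t < 2 * pi -> radial f t (F t)}].
Proof.
move=> /hardy2P[c sc cf].
pose al k := complex.Re (c k); pose be k := complex.Im (c k); pose nal k := - al k.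
have f0 : f 0 = c 0%N.
  have d0 : in_disc (0 : R[i]) by apply/in_discE; rewrite nc0.
  apply: (cvgC_unique (cf 0 d0)); apply/cvg_succ.
  rewrite [X in X @ _ --> _](_ : _ = fun=> c 0%N); first exact: cvg_cst.
  apply/funext => n; rewrite /series /= big_nat_recl // expr0 mulr1 big1 ?addr0 // => i _.
  by rewrite expr0n mulr0.
have term (t r : R) k : c k * (r%:C%C * expi t) ^+ k =
    (trig al be k t * r ^+ k +i* (trig be nal k t * r ^+ k))%C.
  rewrite exprMn expiX -rmorphXn /trig /nal /al /be /expi /=.
  case: (c k) => x y; rewrite /=; simpc.
  by congr (_ +i* _)%C; ring.
have abel_re (t r : R) : 0 < r < 1 -> abel_sum al be t r @ \oo --> complex.Re (f (r%:C%C * expi t)).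
  move=> hr; suff -> : abel_sum al be t r =
      (fun n => complex.Re (series (fun k => c k * (r%:C%C * expi t) ^+ k) n)).
    exact: (cvg_Re _ (cf _ (in_disc_radius t hr))).
  by apply/funext => n; rewrite Re_series; apply: eq_bigr => i _; rewrite term.
have abel_im (t r : R) : 0 < r < 1 -> abel_sum be nal t r @ \oo --> complex.Im (f (r%:C%C * expi t)).
  move=> hr; suff -> : abel_sum be nal t r =
      (fun n => complex.Im (series (fun k => c k * (r%:C%C * expi t) ^+ k) n)).
    exact: (cvg_Im _ (cf _ (in_disc_radius t hr))).
  by apply/funext => n; rewrite Im_series; apply: eq_bigr => i _; rewrite term.
have s1 : cvgn (series (fun k => al k ^+ 2 + be k ^+ 2)).
  by move: sc; rewrite /sqsum; under eq_fun do rewrite nc_sqr.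
have s2 : cvgn (series (fun k => be k ^+ 2 + nal k ^+ 2)).
  by move: s1; rewrite /nal; under eq_fun do rewrite addrC -[al _ ^+ 2]sqrrN.
have [g1 [ig1 mg1 lg1]] := trig_fatou (u := fun t r => complex.Re (f (r%:C%C * expi t))) s1 abel_re.
have [g2 [ig2 mg2 lg2]] := trig_fatou (u := fun t r => complex.Im (f (r%:C%C * expi t))) s2 abel_im.
exists (fun t => (g1 t +i* g2 t)%C); split => //=.
- by rewrite mg1 f0.
- by rewrite mg2 f0.
- move: lg1 lg2; apply: filterS2; first exact: (ae_filter_ringOfSetsType mu).
  by move=> t h1 h2 ht; apply: cvg_complex; [exact: h1|exact: h2].
Qed.

End boundary.

(** * Mean values on the circle and the reproducing property *)

Section inner_product.
Context (R : realType).
Local Notation mu := (@lebesgue_measure R).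
Local Notation nc := (@ComplexField.Normc.normc R).
Local Notation cj x := (x^*%C).
Implicit Types (f g h F G : R[i] -> R[i]) (a z l m v : R[i]) (t : R).

Lemma Rintegral_off_null (N : set R) (u w : R -> R) :
  measurable (N : set (measurableTypeR R)) -> mu N = 0 ->
  (forall t, 0 < t < 2 * pi -> ~ N t -> u t = w t) ->
  \int[mu]_(t in `[0, 2 * pi]) u t = \int[mu]_(t in `[0, 2 * pi]) w t.
Proof.
move=> mN N0 uw; rewrite /Rintegral; congr fine.
(* the endpoints, where the hypothesis says nothing *)
pose E : set R := [set 0] `|` [set 2 * pi].
have mE : measurable (E : set (measurableTypeR R)) by exact: measurableU.
have E0 : mu E = 0.
  apply: null_set_setU => //; exact: lebesgue_measure_set1.
apply: (@eq_integral_off_null _ _ _ mu _ (N `|` E)).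
- exact: measurableU.
- exact: null_set_setU.
- move=> t /=; rewrite in_itv /= => /andP[t0 t2] NE; rewrite uw //; last by move=> Nt; apply: NE; left.
  rewrite !lt_neqAle t0 t2 !andbT; apply/andP; split; apply/eqP => e; apply: NE; right.
    by left; rewrite /= e.
  by right; rewrite /= e.
Qed.

(** The mean value property of H^2, for the sum of an H^2 function and of a conjugate
of one. The function [h] supplies the radial limits from which those of [F] and
[G] are computed. *)
Lemma cintegral_radial h F G (Phi : R -> R[i]) : hardy2 h -> hardy2 F -> hardy2 G ->
  (forall t, 0 < t < 2 * pi -> forall v, radial h t v ->
    exists l m, [/\ radial F t l, radial G t m & Phi t = l + cj m]) ->
  cintegral Phi = (2 * pi)%:C%C * (F 0 + cj (G 0)).
Proof.
move=> /hardy2_fatou[h' [_ _ _ _ hr]] /hardy2_fatou[F' [iF1 iF2 mF1 mF2 Fr]].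
move=> /hardy2_fatou[G' [iG1 iG2 mG1 mG2 Gr]] HP.
have : {ae mu, forall t, 0 < t < 2 * pi -> Phi t = F' t + cj (G' t)}.
  move: hr Fr Gr; apply: filterS3; first exact: (ae_filter_ringOfSetsType mu).
  move=> t hr Fr Gr ht; have [l [m [Fl Gm ->]]] := HP t ht _ (hr ht).
  by rewrite (radial_unique Fl (Fr ht)) (radial_unique Gm (Gr ht)).
move=> [N [mN N0 subN]].
have PhiE t : 0 < t < 2 * pi -> ~ N t -> Phi t = F' t + cj (G' t).
  by move=> ht Nt; apply: contrapT => H; apply: Nt; apply: subN => /= /(_ ht).
rewrite /cintegral.
rewrite (@Rintegral_off_null N (fun t => complex.Re (Phi t)) (fun t => complex.Re (F' t) + complex.Re (G' t)) mN N0); last first.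
  by move=> t ht Nt; rewrite PhiE //; case: (F' t) => ? ?; case: (G' t).
rewrite (@Rintegral_off_null N (fun t => complex.Im (Phi t)) (fun t => complex.Im (F' t) - complex.Im (G' t)) mN N0); last first.
  by move=> t ht Nt; rewrite PhiE //; case: (F' t) => ? ?; case: (G' t).
rewrite RintegralD // RintegralB // mF1 mF2 mG1 mG2.
by case: (F 0) => ? ?; case: (G 0) => ? ?; simpc; congr (_ +i* _)%C; rewrite /=; ring.
Qed.

Lemma inner_radial h F G f g : hardy2 h -> hardy2 F -> hardy2 G ->
  (forall t, 0 < t < 2 * pi -> forall v, radial h t v ->
    exists l m, [/\ radial F t l, radial G t m &
      boundary f t * cj (boundary g t) = l + cj m]) ->
  inner f g = F 0 + cj (G 0).
Proof.
move=> hh hF hG H; rewrite /inner (cintegral_radial hh hF hG H) mulrA.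
have p0 : 2 * pi != 0 :> R by rewrite gt_eqF // mulr_gt0 // pi_gt0.
by rewrite -rmorphM /= mulVf // mul1r.
Qed.

Definition szego_cst a : R[i] := sqrtC (1 - `|a| ^+ 2).

Lemma szego_cst_ge0 a : in_disc a -> 0 <= szego_cst a.
Proof.
move=> /in_discE a1.
rewrite sqrtC_ge0 normE subr_ge0 -rmorphXn -(rmorph1 (real_complex R)) lecR.
by rewrite exprn_ile1 ?nc_ge0 // ltW.
Qed.

Lemma szego_cst_real a : in_disc a -> cj (szego_cst a) = szego_cst a.
Proof.
move=> /szego_cst_ge0/ger0_real/complex_realP[k ->].
by rewrite /= oppr0.
Qed.

Lemma szego_cst_sqr a : in_disc a -> szego_cst a ^+ 2 = 1 - a * cj a.
Proof. by move=> a1; rewrite sqrtCK sqr_normc. Qed.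

Lemma szego_cst_neq0 a : in_disc a -> szego_cst a != 0.
Proof.
move=> ad; have := disc_mul_neq1 ad ad; rewrite mulrC -szego_cst_sqr //.
by rewrite sqrf_eq0.
Qed.

Lemma radial_div f a t l : in_disc a -> radial f t l ->
  radial (fun z => f z / (1 - cj a * z)) t (l / (1 - cj a * expi t)).
Proof.
move=> ad fl; apply: radialM; first exact: fl.
apply: radialV; first exact: expi_den_neq0.
apply: radialB; first exact: radial_cst.
by apply: radialM; [exact: radial_cst|exact: radial_id].
Qed.

Lemma radial_szego a t : in_disc a -> radial (szego a) t (szego_cst a / (1 - cj a * expi t)).
Proof. by move=> ad; apply: (radial_div ad); exact: radial_cst. Qed.

Lemma conj_expi t : cj (expi t) = (expi t)^-1.
Proof. by apply: (mulfI (expi_neq0 t)); rewrite expi_conj mulfV // expi_neq0. Qed.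

Lemma expi_sub_neq0 a t : in_disc a -> expi t - a != 0.
Proof.
move=> /in_discE a1; rewrite subr_eq0; apply/eqP => h.
by move: a1; rewrite -h nc_expi ltxx.
Qed.

Lemma conj_expi_den a t : in_disc a ->
  cj (1 - cj a * expi t) = (expi t - a) / expi t.
Proof.
move=> ad; have := conj_expi t; move: (expi t) (expi_neq0 t) => e e0 he.
by rewrite rmorphB rmorphM rmorph1 /= conjcK he; field.
Qed.

(** On the circle [conj (e_a)] is a multiple of [z / (z - a)]. With [f = f(a) +
(z - a) g] this turns [f * conj (e_a)] into a multiple of [z * g], which vanishes
at 0, plus the conjugate of a multiple of [1 / (1 - conj(a) z)], which is 1 at 0. *)
Lemma inner_szego f a : hardy2 f -> in_disc a -> inner f (szego a) = szego_cst a * f a.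
Proof.
move=> hf ad; have [g hg fg] := hardy2_factor hf ad.
set s := szego_cst a.
pose F z := s * (z * g z); pose G z := cj (s * f a) / (1 - cj a * z).
have hF : hardy2 F by apply: hardy2Z; exact: hardy2_mulX.
have hG : hardy2 G by exact: (hardy2_div ad (hardy2_cst _)).
rewrite (@inner_radial g F G f (szego a) hg hF hG).
  by rewrite /F /G mul0r mulr0 add0r mulr0 subr0 divr1 conjcK.
move=> t _ v gv; exists (s * (expi t * v)), (cj (s * f a) / (1 - cj a * expi t)).
have rf : radial f t (f a + (expi t - a) * v).
  apply: (radial_ext (f := fun z => f a + (z - a) * g z)).
    by move=> z zd; rewrite -fg.
  apply: radialD; first exact: radial_cst.
  apply: radialM; last exact: gv.
  by apply: radialB; [exact: radial_id|exact: radial_cst].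
split.
- apply: radialM; first exact: radial_cst.
  by apply: radialM; [exact: radial_id|exact: gv].
- by apply: (radial_div ad); exact: radial_cst.
rewrite (boundaryE rf) (boundaryE (radial_szego (t := t) ad)) -/s.
rewrite !rmorphM !fmorphV /= conj_expi_den // szego_cst_real // -/s ?conjcK.
have e0 := expi_neq0 t; have ea := expi_sub_neq0 t ad.
move: ea; set e := expi t in e0 *; move=> ea.
rewrite ?szego_cst_real // -/s.
by field; rewrite e0 ea.
Qed.

End inner_product.

(** * First-order condition at an optimal parameter *)

Section sifting.
Context (R : realType).
Local Notation nc := (@ComplexField.Normc.normc R).
Local Notation cj x := (x^*%C).
Implicit Types (f g h F G : R[i] -> R[i]) (a b z : R[i]).

Lemma hardy2_mul_sub f a : hardy2 f -> hardy2 (fun z => (z - a) * f z).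
Proof.
move=> hf; apply: (hardy2_ext (f := fun z => z * f z - a * f z)).
  by move=> z _; rewrite mulrBl.
exact: (hardy2B (hardy2_mulX hf) (hardy2Z a hf)).
Qed.

Lemma hardy2_mul_den f a : hardy2 f -> hardy2 (fun z => (1 - cj a * z) * f z).
Proof.
move=> hf; apply: (hardy2_ext (f := fun z => f z - cj a * (z * f z))).
  by move=> z _; rewrite mulrBl mul1r mulrA.
exact: (hardy2B hf (hardy2Z (cj a) (hardy2_mulX hf))).
Qed.

Lemma hardy2_blaschke f a : in_disc a -> hardy2 f -> hardy2 (fun z => blaschke a z * f z).
Proof.
move=> ad hf; apply: (hardy2_ext (f := fun z => (z - a) * f z / (1 - cj a * z))).
  by move=> z _; rewrite /blaschke mulrAC.
exact: (hardy2_div ad (hardy2_mul_sub a hf)).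
Qed.

Lemma hardy2_szego a : in_disc a -> hardy2 (szego a).
Proof. by move=> ad; exact: (hardy2_div ad (hardy2_cst _)). Qed.

Lemma nc_sqrD (x y : R[i]) :
  nc (x + y) ^+ 2 = nc x ^+ 2 + nc y ^+ 2 + 2 * complex.Re (cj x * y).
Proof. by case: x => ? ?; case: y => ? ?; rewrite !nc_sqr /=; ring. Qed.

(** Equivalently, the square of the modulus of the Blaschke factor is one minus
[(1 - |a|^2) (1 - |b|^2) / |1 - conj(a) b|^2]. *)
Lemma nc_sqr_den a b :
  nc (1 - cj a * b) ^+ 2 = nc (b - a) ^+ 2 + (1 - nc b ^+ 2) * (1 - nc a ^+ 2).
Proof. by case: a => ? ?; case: b => ? ?; rewrite !nc_sqr /=; ring. Qed.

Lemma nc_szego_cst a : in_disc a -> nc (szego_cst a) ^+ 2 = 1 - nc a ^+ 2.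
Proof.
move=> ad; apply: (@complexI R).
by rewrite nc_sqrC szego_cst_real // -expr2 szego_cst_sqr // rmorphB rmorph1 /= -nc_sqrC.
Qed.

Lemma Re_mul_real (x : R) (w : R[i]) : complex.Re (x%:C%C * w) = x * complex.Re w.
Proof. by case: w => u v; simpc; rewrite /=; ring. Qed.

Lemma cvg_nc (T : Type) (F : set_system T) (FF : Filter F) (f : T -> R[i]) (l : R[i]) :
  f @ F --> l -> nc (f x) @[x --> F] --> nc l.
Proof.
move=> /cvgC_normcP H; apply/cvgrPdist_le => e /H; apply: filterS => x.
by apply: le_trans; exact: nc_dist.
Qed.

(** Multiply [(1 - |b|^2) |f(b)|^2 <= |lam|^2] by [|1 - conj(a) b|^2] and expand with
[nc_sqr_den]: the terms of order 0 cancel, leaving a term linear in [b - a]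
bounded by a quadratic one. *)
Lemma optimal_ineq f a b (K : R[i]) : hardy2 f -> optimal f a -> in_disc b ->
  let lam := inner f (szego a) in
  (1 - cj a * b) * f b = lam * szego_cst a + (b - a) * K ->
  (1 - nc b ^+ 2) * (2 * complex.Re (cj (lam * szego_cst a) * ((b - a) * K))) <=
  nc lam ^+ 2 * nc (b - a) ^+ 2.
Proof.
move=> hf [ad opt] bd lam fb.
have h0 : nc (szego_cst b * f b) <= nc lam.
  by have := opt b bd; rewrite (inner_szego hf bd) !normE lecR.
have b0 : 0 < 1 - nc b ^+ 2.
  by move/in_discE : bd => b1; rewrite subr_gt0 exprn_ilt1 ?nc_ge0.
have {}h0 : (1 - nc b ^+ 2) * nc (f b) ^+ 2 <= nc lam ^+ 2.
  by rewrite -nc_szego_cst // -exprMn -ncM lerXn2r ?nnegrE ?nc_ge0.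
have h1 := ler_wpM2r (sqr_ge0 (nc (1 - cj a * b))) h0.
rewrite -mulrA -exprMn -ncM [f b * _]mulrC fb nc_sqrD ncM exprMn nc_szego_cst // in h1.
rewrite nc_sqr_den in h1.
move: h1; set X := complex.Re _; set L := nc lam ^+ 2; set B := nc b ^+ 2 in b0 *.
set A := nc a ^+ 2; set D := nc (b - a) ^+ 2.
have Q0 : 0 <= nc ((b - a) * K) ^+ 2 by exact: sqr_ge0.
move: (nc ((b - a) * K) ^+ 2) Q0 => Q Q0 h1.
have : 0 <= (1 - B) * Q by rewrite mulr_ge0 // ltW.
by move: h1; rewrite !mulrDr; lra.
Qed.

(** The residual vanishes at [a] by the reproducing property. If its derivative did
not, moving [b] away from [a] in the direction that makes the linear term of
[optimal_ineq] positive would contradict that inequality, unless [lam = 0], and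
then [f] is 0 on the disc. *)
Lemma optimal_double_zero f a : hardy2 f -> optimal f a ->
  exists2 h, hardy2 h & forall z, in_disc z ->
    f z - inner f (szego a) * szego a z = (z - a) ^+ 2 * h z.
Proof.
move=> hf opta; have [ad opt] := opta.
set lam := inner f (szego a); set s := szego_cst a.
have lamE : lam = s * f a by exact: inner_szego.
have [lam0|lam0] := eqVneq lam 0.
  exists (fun _ => 0); first exact: hardy2_cst.
  move=> z zd; rewrite lam0 mul0r subr0 mulr0.
  have := opt z zd; rewrite -/lam lam0 normr0 normr_le0 (inner_szego hf zd).
  by rewrite mulf_eq0 (negbTE (szego_cst_neq0 zd)) => /eqP.
pose r z := f z - lam * szego a z.
have hr : hardy2 r by exact: (hardy2B hf (hardy2Z lam (hardy2_szego ad))).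
have ra : r a = 0.
  have d0 := disc_mul_neq1 ad ad.
  rewrite /r lamE /szego -/(szego_cst a) -/s.
  have -> : s * f a * (s / (1 - cj a * a)) = s ^+ 2 / (1 - cj a * a) * f a by field.
  by rewrite szego_cst_sqr // [a * _]mulrC divff // mul1r subrr.
have [H hH rH] := hardy2_factor hr ad.
have {}rH z : in_disc z -> r z = (z - a) * H z by move=> /rH; rewrite ra add0r.
have [h hh Hh] := hardy2_factor hH ad.
suff Ha : H a = 0.
  exists h; first exact: hh.
  by move=> z zd; rewrite -/(r z) rH // Hh // Ha add0r; ring.
pose K z := (1 - cj a * z) * H z.
have hK : hardy2 K by exact: hardy2_mul_den.
suff : K a = 0.
  by move/eqP; rewrite mulf_eq0 (negbTE (disc_mul_neq1 ad ad)) => /eqP.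
apply/eqP; apply: contraT => Ka0.
have fK b : in_disc b -> (1 - cj a * b) * f b = lam * s + (b - a) * K b.
  move=> bd; have d0 := disc_mul_neq1 ad bd.
  have : f b = r b + lam * szego a b by rewrite /r subrK.
  rewrite rH // /szego -/(szego_cst a) -/s /K => ->.
  by field.
pose sg := nc s.
have sE : s = sg%:C%C.
  by rewrite -normE ger0_norm // szego_cst_ge0.
have sg0 : 0 < sg by rewrite nc_gt0 szego_cst_neq0.
(* along this direction the linear term is positive to first order *)
pose om := lam * cj (K a).
pose b (t : R) := a + t%:C%C * om.
have bcvg : b t @[t --> (0 : R)^'+] --> a.
  rewrite -[X in _ --> X]addr0 -[X in _ --> _ + X](mul0r om).
  apply: cvgD; first exact: cvg_cst.
  apply: cvgM; last exact: cvg_cst.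
  apply: (@cvg_real_complex R _ (0 : R)^'+).
  by apply: cvg_at_right_filter; exact: cvg_id.
have Kcvg : K (b t) @[t --> (0 : R)^'+] --> K a.
  exact: (cvg_comp _ _ bcvg (hardy2_continuous hK ad)).
have L0 : 0 < nc lam ^+ 2 by rewrite exprn_gt0 // nc_gt0.
pose V t := complex.Re (cj (K a) * K (b t)).
(* the inequality divided by [t * nc lam ^+ 2] *)
pose phi t := (1 - nc (b t) ^+ 2) * (2 * (sg * V t)) - t * nc om ^+ 2.
have phi_le : \forall t \near (0 : R)^'+, phi t <= 0.
  near=> t.
  have t0 : 0 < t by near: t; exact: nbhs_right_gt.
  have bd : in_disc (b t) by near: t; exact: (bcvg _ (near_in_disc ad)).
  have := optimal_ineq hf opta bd (fK _ bd); rewrite -/lam -/s.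
  have -> : b t - a = t%:C%C * om by rewrite /b addrC addKr.
  have -> : cj (lam * s) * (t%:C%C * om * K (b t)) =
      (t * (sg * nc lam ^+ 2))%:C%C * (cj (K a) * K (b t)).
    have -> : (t * (sg * nc lam ^+ 2))%:C%C = t%:C%C * (s * (lam * cj lam)).
      by rewrite -nc_sqrC [in RHS]sE !(rmorphM (real_complex R)).
    have -> : cj (lam * s) = cj lam * s.
      by rewrite rmorphM [X in _ * X](szego_cst_real ad).
    by rewrite /om; ring.
  have -> : complex.Re ((t * (sg * nc lam ^+ 2))%:C%C * (cj (K a) * K (b t))) =
      t * (sg * nc lam ^+ 2) * V t.
    exact: Re_mul_real.
  rewrite ncM nc_real (gtr0_norm t0) exprMn => ineq.
  have : t * nc lam ^+ 2 * phi t <= 0.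
    move: ineq; rewrite -subr_le0; apply: le_trans; rewrite le_eqVlt; apply/orP; left; apply/eqP.
    by rewrite /phi; ring.
  by rewrite pmulr_rle0 // mulr_gt0.
have phi_cvg : phi t @[t --> (0 : R)^'+] -->
    (1 - nc a ^+ 2) * (2 * (sg * nc (K a) ^+ 2)) - 0 * nc om ^+ 2.
  apply: cvgB; last first.
    apply: cvgM; last exact: cvg_cst.
    by apply: cvg_at_right_filter; exact: cvg_id.
  apply: cvgM.
    apply: cvgB; first exact: cvg_cst.
    by apply: cvgM; exact: (cvg_nc _ bcvg).
  apply: cvgMr; apply: cvgMr.
  have -> : nc (K a) ^+ 2 = complex.Re (cj (K a) * K a).
    by rewrite mulrC -nc_sqrC.
  by apply: cvg_Re; apply: cvgMr; exact: Kcvg.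
have lim0 : 0 < (1 - nc a ^+ 2) * (2 * (sg * nc (K a) ^+ 2)) - 0 * nc om ^+ 2.
  rewrite mul0r subr0 mulr_gt0 //.
    by move/in_discE : ad => a1; rewrite subr_gt0 exprn_ilt1 ?nc_ge0.
  by rewrite !mulr_gt0 // ?exprn_gt0 // nc_gt0.
have phi_gt : \forall t \near (0 : R)^'+, 0 < phi t.
  by apply: (cvgr_gt _ phi_cvg).
near (0 : R)^'+ => t.
have h1 : phi t <= 0 by near: t.
have h2 : 0 < phi t by near: t.
by move: (lt_le_trans h2 h1); rewrite ltxx.
Unshelve. all: by end_near. Qed.

End sifting.

(** * The sifting process *)

Section main.
Context (R : realType).
Local Notation nc := (@ComplexField.Normc.normc R).
Local Notation cj x := (x^*%C).
Implicit Types (f g h F G : R[i] -> R[i]) (b z : R[i]) (a : nat -> R[i]).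

(** Dividing the double zero by [blaschke b ^+ 2] leaves [(1 - conj(b) z)^2 h(z)],
which is continuous at [b]. *)
Lemma sift_step f b : hardy2 f -> optimal f b ->
  exists H, [/\ hardy2 H, sift_quotient f b z @[z --> b^'] --> H b,
    (forall z, in_disc z -> remove_sing (sift_quotient f b) b z = H z) &
    (forall z, in_disc z ->
      f z = inner f (szego b) * szego b z + blaschke b z ^+ 2 * H z)].
Proof.
move=> hf optb; have [bd _] := optb.
have [h hh hE] := optimal_double_zero hf optb.
pose H z := (1 - cj b * z) * ((1 - cj b * z) * h z).
have hH : hardy2 H by exact: (hardy2_mul_den b (hardy2_mul_den b hh)).
have qE z : in_disc z -> z != b -> sift_quotient f b z = H z.
  move=> zd zb; rewrite /sift_quotient hE // /blaschke /H.
  have zb0 : z - b != 0 by rewrite subr_eq0.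
  have d0 := disc_mul_neq1 bd zd.
  by field; rewrite d0 zb0.
have lim : sift_quotient f b z @[z --> b^'] --> H b.
  have N1 : \forall z \near b^', in_disc z by exact: nbhs_dnbhs (near_in_disc bd).
  have N2 : \forall z \near b^', z != b by exact: nbhs_dnbhs_neq.
  have E : \forall z \near b^', H z = sift_quotient f b z.
    by apply: filterS2 N1 N2 => z zd zb; rewrite qE.
  apply: cvg_trans (near_eq_cvg E) _.
  by move=> P hP; apply: nbhs_dnbhs; exact: hardy2_continuous hH bd P hP.
exists H; split; [exact: hH|exact: lim| |].
- move=> z zd; rewrite /remove_sing; case: eqVneq => [->|zb]; last exact: qE.
  by apply: (cvg_lim _ lim); exact: norm_hausdorff.
- move=> z zd; have d0 := disc_mul_neq1 bd zd.
  apply/eqP; rewrite addrC -subr_eq; apply/eqP; rewrite hE // /blaschke /H.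
  by field.
Qed.

Lemma hardy2_prod_blaschke a m p F : hardy2 F ->
  (forall l, (m <= l < p)%N -> in_disc (a l)) ->
  hardy2 (fun z => (\prod_(m <= l < p) blaschke (a l) z ^+ 2) * F z).
Proof.
move=> hF; elim: p => [|p IH] ad.
  by apply: (hardy2_ext (f := F)) => [z _|]; [rewrite big_geq // mul1r|exact: hF].
have [mp|pm] := leqP m p; last first.
  by apply: (hardy2_ext (f := F)) => [z _|]; [rewrite big_geq // mul1r|exact: hF].
have h1 : hardy2 (fun z => (\prod_(m <= l < p) blaschke (a l) z ^+ 2) * F z).
  by apply: IH => l /andP[ml lp]; apply: ad; rewrite ml ltnW.
have pd : in_disc (a p) by apply: ad; rewrite mp ltnSn.
apply: (hardy2_ext _ (hardy2_blaschke pd (hardy2_blaschke pd h1))) => z _.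
by rewrite big_nat_recr //=; ring.
Qed.

Lemma hardy2_sum (I : eqType) (r : seq I) (u : I -> R[i] -> R[i]) :
  (forall i, i \in r -> hardy2 (u i)) -> hardy2 (fun z => \sum_(i <- r) u i z).
Proof.
elim: r => [_|i r IH hu].
  by apply: (hardy2_ext (f := fun _ => 0)) => [z _|]; [rewrite big_nil|exact: hardy2_cst].
apply: (hardy2_ext (f := fun z => u i z + \sum_(j <- r) u j z)) => [z _|].
  by rewrite big_cons.
apply: hardy2D; first by apply: hu; rewrite mem_head.
by apply: IH => j jr; apply: hu; rewrite in_cons jr orbT.
Qed.

Lemma radial_sum (I : eqType) (r : seq I) (u : I -> R[i] -> R[i]) (w : I -> R[i]) (t : R) :
  (forall i, i \in r -> radial (u i) t (w i)) ->
  radial (fun z => \sum_(i <- r) u i z) t (\sum_(i <- r) w i).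
Proof.
elim: r => [_|i r IH hu].
  rewrite big_nil; apply: (radial_ext (f := fun _ => 0)) => [z _|].
    by rewrite big_nil.
  exact: radial_cst.
rewrite big_cons; apply: (radial_ext (f := fun z => u i z + \sum_(j <- r) u j z)) => [z _|].
  by rewrite big_cons.
apply: radialD; first by apply: hu; rewrite mem_head.
by apply: IH => j jr; apply: hu; rewrite in_cons jr orbT.
Qed.

Lemma radial_blaschke b (t : R) : in_disc b -> radial (blaschke b) t (blaschke b (expi t)).
Proof.
move=> bd; apply: (radial_div bd).
by apply: radialB; [exact: radial_id|exact: radial_cst].
Qed.

Lemma radial_prod_blaschke a m p (t : R) : (forall l, (m <= l < p)%N -> in_disc (a l)) ->
  radial (fun z => \prod_(m <= l < p) blaschke (a l) z ^+ 2) t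
    (\prod_(m <= l < p) blaschke (a l) (expi t) ^+ 2).
Proof.
elim: p => [_|p IH ad].
  rewrite big_geq //; apply: (radial_ext (f := fun _ => 1)) => [z _|].
    by rewrite big_geq.
  exact: radial_cst.
have [mp|pm] := leqP m p; last first.
  rewrite big_geq //; apply: (radial_ext (f := fun _ => 1)) => [z _|].
    by rewrite big_geq.
  exact: radial_cst.
have pd : in_disc (a p) by apply: ad; rewrite mp ltnSn.
rewrite big_nat_recr //=.
apply: (radial_ext (f := fun z => \prod_(m <= l < p) blaschke (a l) z ^+ 2 *
    (blaschke (a p) z * blaschke (a p) z))) => [z _|].
  by rewrite big_nat_recr.
apply: radialM; last by apply: radialM; exact: radial_blaschke.
by apply: IH => l /andP[ml lp]; apply: ad; rewrite ml ltnW.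
Qed.

Lemma blaschke_conj b (t : R) : in_disc b ->
  blaschke b (expi t) * cj (blaschke b (expi t)) = 1.
Proof.
move=> bd; rewrite /blaschke rmorphM fmorphV [X in _ * (_ * X^-1)]conj_expi_den //.
have := conj_expi t; have := expi_den_neq0 t bd; have := expi_sub_neq0 t bd.
move: (expi t) (expi_neq0 t) => e e0 eb eb' he.
by rewrite rmorphB /= he; field; rewrite e0 eb eb'.
Qed.

Section sifting_process.
Variables (f : R[i] -> R[i]) (n : nat) (a : nat -> R[i]).
Hypothesis hf : hardy2 f.
Hypothesis ha : forall k, (1 <= k <= n)%N -> optimal (remainder f a k) (a k).

Let ad k : (1 <= k <= n)%N -> in_disc (a k).
Proof. by move=> /ha[]. Qed.

Lemma remainderS k : (1 <= k)%N ->
  remainder f a k.+1 = remove_sing (sift_quotient (remainder f a k) (a k)) (a k).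
Proof. by case: k. Qed.

Lemma hardy2_remainder k : (1 <= k <= n.+1)%N -> hardy2 (remainder f a k).
Proof.
elim: k => [/andP[k0 _]|k IH /andP[_ kn]]; first by discriminate k0.
case: (posnP k) => [->|k0]; first exact: hf.
have kn' : (1 <= k <= n)%N by rewrite k0.
have hk : hardy2 (remainder f a k) by apply: IH; rewrite k0 ltnW.
have [H [hH _ HE _]] := sift_step hk (ha kn').
rewrite (remainderS k0); apply: (hardy2_ext _ hH) => z zd.
by rewrite HE.
Qed.

Lemma remainder_cvg k : (1 <= k <= n)%N ->
  cvg (sift_quotient (remainder f a k) (a k) z @[z --> (a k)^']).
Proof.
move=> kn; have hk : hardy2 (remainder f a k).
  by apply: hardy2_remainder; case/andP: kn => -> /leqW.
have [H [_ lim _ _]] := sift_step hk (ha kn).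
by apply/cvg_ex; exists (H (a k)); exact: lim.
Qed.

Lemma sifting_expansion m z : (m <= n)%N -> in_disc z ->
  f z = \sum_(1 <= k < m.+1) coef f a k * double_TM a k z
        + remainder f a m.+1 z * \prod_(1 <= k < m.+1) blaschke (a k) z ^+ 2.
Proof.
move=> mn zd; elim: m mn => [|m IH] mn.
  by rewrite !big_geq // add0r mulr1.
have kn : (1 <= m.+1 <= n)%N by [].
have hk : hardy2 (remainder f a m.+1) by exact: (@hardy2_remainder m.+1 (leqW mn)).
have [H [_ _ HE fE]] := sift_step hk (ha kn).
rewrite big_nat_recr //= [X in _ = _ + _ * X]big_nat_recr //=.
rewrite {1}IH ?(ltnW mn) // fE // -/(coef f a m.+1).
rewrite -/(remainder f a m.+2) (remainderS (ltn0Sn m)) HE // /double_TM.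
by ring.
Qed.

Lemma partial_sumE z : in_disc z ->
  f z - partial_sum f a n z = (\prod_(1 <= k < n.+1) blaschke (a k) z ^+ 2) * remainder f a n.+1 z.
Proof.
by move=> zd; rewrite {1}(sifting_expansion (leqnn n) zd) -/(partial_sum f a n z) addrAC subrr add0r mulrC.
Qed.

Let hrem : hardy2 (remainder f a n.+1).
Proof. exact: (@hardy2_remainder n.+1 (leqnn n.+1)). Qed.

Lemma interpolation_factor k : (1 <= k <= n)%N -> exists2 G, hardy2 G &
  forall z, in_disc z -> f z - partial_sum f a n z = (z - a k) ^+ 2 * G z.
Proof.
move=> kn; have /andP[k1 k2] := kn; have kd := ad kn.
have h1 : hardy2 (fun z => (\prod_(k.+1 <= l < n.+1) blaschke (a l) z ^+ 2) * remainder f a n.+1 z).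
  apply: hardy2_prod_blaschke => [|l /andP[l1 l2]]; first exact: hrem.
  by apply: ad; rewrite (leq_trans _ l1).
have h2 := hardy2_prod_blaschke (a := a) (m := 1) (p := k) h1.
have h3 := hardy2_div kd (hardy2_div kd (h2 _)).
eexists; first apply: h3.
  by move=> l /andP[l1 l2]; apply: ad; rewrite l1 ltnW // (leq_trans l2).
move=> z zd; rewrite partial_sumE // (@big_cat_nat _ _ _ k) //=; last by rewrite ltnW.
rewrite [X in _ * X * _]big_ltn // /blaschke.
have d0 := disc_mul_neq1 kd zd.
by field.
Qed.

(** [f] and the partial sum differ by [(z - a k)^2 * G], so both have the form
[f(a k) + (z - a k) * g] with the same value of [g] at [a k]. *)
Lemma interpolation k : (1 <= k <= n)%N ->
  [/\ partial_sum f a n (a k) = f (a k), derivable f (a k) 1,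
      derivable (partial_sum f a n) (a k) 1 &
      (partial_sum f a n)^`() (a k) = f^`() (a k)].
Proof.
move=> kn; have kd := ad kn.
have [G hG GE] := interpolation_factor kn.
have [g hg fg] := hardy2_factor hf kd.
have Pa : partial_sum f a n (a k) = f (a k).
  by apply/esym/eqP; rewrite -subr_eq0 GE // subrr expr0n mul0r.
have df := hardy2_is_derive hg kd fg.
have hg2 : hardy2 (fun z => g z - (z - a k) * G z) by exact: (hardy2B hg (hardy2_mul_sub (a k) hG)).
have Pg z : in_disc z -> partial_sum f a n z =
    partial_sum f a n (a k) + (z - a k) * (g z - (z - a k) * G z).
  move=> zd; rewrite Pa; have := GE z zd; rewrite fg // => h.
  have -> : partial_sum f a n z = f (a k) + (z - a k) * g z - (z - a k) ^+ 2 * G z.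
    by rewrite -h; ring.
  by ring.
have dP := hardy2_is_derive hg2 kd Pg.
split; [exact: Pa|by case: df|by case: dP|].
by rewrite !derive1E !derive_val subrr mul0r subr0.
Qed.

(** On the circle the Blaschke factors of index below [k] in [f - S_n] cancel those of
[conj (B_k)], and one factor of index [k] absorbs the pole of [conj (e_(a k))] at
[a k]. The function [F] below is the resulting H^2 function; it has a factor [z]. *)
Lemma partial_sum_orth_proj : is_orth_proj (double_TM a) n f (partial_sum f a n).
Proof.
split; first by exists (coef f a).
move=> g [lam gE].
pose u k z := cj (lam k) * szego_cst (a k) *
  (z * (blaschke (a k) z / (1 - cj (a k) * z) *
    ((\prod_(k.+1 <= l < n.+1) blaschke (a l) z ^+ 2) * remainder f a n.+1 z))).
have rng k l : (k.+1 <= l < n.+1)%N -> in_disc (a l).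
  by move=> /andP[l1 l2]; apply: ad; rewrite (leq_trans _ l1).
have rng0 k l : (k <= n)%N -> (1 <= l < k)%N -> in_disc (a l).
  by move=> kn /andP[l1 l2]; apply: ad; rewrite l1 ltnW // (leq_trans l2).
have hu k : k \in index_iota 1 n.+1 -> hardy2 (u k).
  rewrite mem_index_iota => kn; have kd : in_disc (a k) by apply: ad.
  have h1 := hardy2_prod_blaschke hrem (rng k).
  suff hi : hardy2 (fun z => blaschke (a k) z / (1 - cj (a k) * z) *
      ((\prod_(k.+1 <= l < n.+1) blaschke (a l) z ^+ 2) * remainder f a n.+1 z)).
    exact: (hardy2Z _ (hardy2_mulX hi)).
  apply: (hardy2_ext _ (hardy2_blaschke kd (hardy2_div kd h1))) => z _.
  by rewrite mulrA mulrAC.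
pose F z := \sum_(1 <= k < n.+1) u k z.
have hF : hardy2 F by exact: hardy2_sum.
rewrite (@inner_radial R (remainder f a n.+1) F (fun _ => 0) _ _ hrem hF (hardy2_cst 0)).
  by rewrite conjc0 addr0 /F big1 // => k _; rewrite /u mul0r mulr0.
move=> t _ v rv.
have rP : radial (fun z => f z - partial_sum f a n z) t
    ((\prod_(1 <= k < n.+1) blaschke (a k) (expi t) ^+ 2) * v).
  apply: (radial_ext (fun z zd => esym (partial_sumE zd))).
  apply: radialM; last exact: rv.
  by apply: radial_prod_blaschke => l /(rng 0).
have rg : radial g t (\sum_(1 <= k < n.+1) lam k * double_TM a k (expi t)).
  apply: (radial_ext (fun z zd => esym (gE z zd))).
  apply: radial_sum => k; rewrite mem_index_iota => kn.
  apply: radialM; first exact: radial_cst.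
  apply: radialM; first by apply: radial_szego; apply: ad.
  by apply: radial_prod_blaschke => l; apply: rng0; case/andP: kn.
exists (\sum_(1 <= k < n.+1) cj (lam k) * szego_cst (a k) *
  (expi t * (blaschke (a k) (expi t) / (1 - cj (a k) * expi t) *
    ((\prod_(k.+1 <= l < n.+1) blaschke (a l) (expi t) ^+ 2) * v)))), 0.
split.
- apply: radial_sum => k; rewrite mem_index_iota => kn; have kd : in_disc (a k) by apply: ad.
  apply: radialM; first exact: radial_cst.
  apply: radialM; first exact: radial_id.
  apply: radialM; first by apply: (radial_div kd); exact: radial_blaschke.
  apply: radialM; last exact: rv.
  by apply: radial_prod_blaschke; exact: rng.
- exact: radial_cst.
rewrite (boundaryE rP) (boundaryE rg) conjc0 addr0 rmorph_sum mulr_sumr.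
apply: eq_big_nat => k kn; have kd : in_disc (a k) by apply: ad.
have /andP[k1 k2] := kn.
rewrite (@big_cat_nat _ _ _ k) //=; last by rewrite ltnW.
rewrite [\prod_(k <= i < n.+1) _]big_ltn // /double_TM.
set A := \prod_(1 <= l < k) _; set B := \prod_(k.+1 <= l < n.+1) _.
have AA : A * cj A = 1.
  rewrite /A rmorph_prod -big_split big1_seq // => l /=; rewrite mem_index_iota => lk.
  rewrite rmorphXn -exprMn [_ * _]blaschke_conj ?expr1n //.
  exact: (rng0 k l k2 lk).
have -> : cj (lam k * (szego (a k) (expi t) * A)) =
    cj (lam k) * (szego_cst (a k) / ((expi t - a k) / expi t)) * cj A.
  rewrite 2!rmorphM mulrA; congr (_ * _ * _).
  rewrite /szego rmorphM fmorphV [X in X * _](szego_cst_real kd).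
  by congr (_ / _); exact: conj_expi_den.
transitivity ((A * cj A) * (blaschke (a k) (expi t) ^+ 2 * B * v *
    (cj (lam k) * (szego_cst (a k) / ((expi t - a k) / expi t))))); first by ring.
rewrite AA mul1r /blaschke.
have := expi_den_neq0 t kd; have := expi_sub_neq0 t kd.
move: (expi t) (expi_neq0 t) => e e0 eb eb'.
by field; rewrite e0 eb eb'.
Qed.
End sifting_process.
End main.

(** * Interpolation by the sifting process *)

Unset Implicit Arguments.
Set Strict Implicit.

Theorem mainTheorem1 (R : realType) (f : R[i] -> R[i]) (n : nat)
    (a : nat -> R[i]) (hf : hardy2 f) (hn : (1 <= n)%N)
    (ha : forall k, (1 <= k <= n)%N -> optimal (remainder f a k) (a k)) :
  [/\ forall k, (1 <= k <= n)%N ->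
        cvg (sift_quotient (remainder f a k) (a k) z @[z --> (a k)^']) /\
        hardy2 (remainder f a k.+1),
      forall z, in_disc z ->
        f z = \sum_(1 <= k < n.+1)
                inner (remainder f a k) (szego (a k)) * double_TM a k z
              + remainder f a n.+1 z * \prod_(1 <= k < n.+1) blaschke (a k) z ^+ 2,
      is_orth_proj (double_TM a) n f (partial_sum f a n) &
      forall k, (1 <= k <= n)%N ->
        [/\ partial_sum f a n (a k) = f (a k),
            derivable f (a k) 1,
            derivable (partial_sum f a n) (a k) 1 &
            (partial_sum f a n)^`() (a k) = f^`() (a k)]].
Proof.
split.
- move=> k kn; split; first exact: (remainder_cvg hf ha kn).
  by apply: (hardy2_remainder hf ha); case/andP: kn => _ kn; rewrite /= ltnS.
- by move=> z zd; exact: (sifting_expansion hf ha (leqnn n) zd).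
- exact: (partial_sum_orth_proj hf ha).
- by move=> k kn; exact: (interpolation hf ha kn).
Qed.
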